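(* Let $G$ be a Lie group with Lie algebra $\mathfrak g$, let $H:T^*G\to\mathbb R$ be a Hamiltonian with left-trivialized Hamiltonian $h:G\times\mathfrak g^*\to\mathbb R$, let $T>0$, $g_0\in G$, $\mu_1\in\mathfrak g^*$. Let $(g,p):[0,T]\to T^*G$ be a curve, and let $(g,\mu):[0,T]\to G\times\mathfrak g^*$, $\mu=g^*\cdot p$, be the corresponding left-trivialized curve. Then the following are equivalent. (i) $g(0)=g_0$, $p(T)=g(T)^{*-1}\cdot\mu_1$, and the Type II d'Alembert variational principle on $T^*G$, $$\delta S[g,p]=\langle p(T),\delta g(T)\rangle,$$ holds for all variations $(\delta g,\delta p)$ of $(g,p)$ satisfying $\delta g(0)=0$, $\delta p(T)=0$ (corresponding to these boundary conditions). (ii) Hamilton's equations hold in canonical coordinates on $T^*G$, with Type II boundary conditions: $$\dot g=D_pH(g,p),\qquad \dot p=-D_gH(g,p),\qquad g(0)=g_0,\qquad p(T)=g(T)^{*-1}\cdot\mu_1.$$ (iii) $g(0)=g_0$, $\mu(T)=\mu_1$, and the Type II d'Alembert variational principle on $G\times\mathfrak g^*$, $$\delta s[g,\mu]=\langle\mu(T),\eta(T)\rangle,$$ holds for all variations with left-trivialized components $\eta=g^{-1}\cdot\delta g$ and $\delta\mu$ satisfying $\eta(0)=0$, $\delta\mu(T)=0$ (corresponding to these boundary conditions). (iv) The Lie--Poisson equations hold on $G\times\mathfrak g^*$, with Type II boundary conditions: $$\dot g=g\cdot D_\mu h(g,\mu),\qquad \dot\mu=-g^*\cdot D_gh(g,\mu)+\mathrm{ad}^*_{D_\mu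 h(g,\mu)}\mu,\qquad g(0)=g_0,\qquad \mu(T)=\mu_1.$$
   Context: All manifolds, maps and curves are smooth. $\langle\cdot,\cdot\rangle$ is the duality pairing between $T_g^*G$ and $T_gG$ (in particular between $\mathfrak g^*$ and $\mathfrak g=T_eG$). $L_g(x)=gx$ is left translation. For $v_g\in T_gG$, $g^{-1}\cdot v_g:=T_gL_{g^{-1}}(v_g)\in\mathfrak g$, and for $\xi\in\mathfrak g$, $g\cdot\xi:=T_eL_g(\xi)\in T_gG$. For $p_g\in T_g^*G$, $g^*\cdot p_g:=T_e^*L_g(p_g)\in\mathfrak g^*$ (the dual of $T_eL_g$ applied to $p_g$), and $g^{*-1}$ denotes the inverse map $\mathfrak g^*\to T_g^*G$. The map $(g,p)\mapsto(g,\mu)$, $\mu=g^*\cdot p$, is the left trivialization $T^*G\cong G\times\mathfrak g^*$. The left-trivialized Hamiltonian is $h(g,\mu)=H(g,g^{*-1}\cdot\mu)$. The actions are $$S[g,p]=\int_0^T\big(\langle p,\dot g\rangle-H(g,p)\big)dt,\qquad s[g,\mu]=\int_0^T\big(\langle\mu,g^{-1}\cdot\dot g\rangle-h(g,\mu)\big)dt,$$ so $S[g,p]=s[g,\mu]$ when $\mu=g^*\cdot p$. Partial derivatives: $dH(g,p)\cdot(\delta g,\delta p)=\langle D_gH,\delta g\rangle+\langle\delta p,D_pH\rangle$ in canonical coordinates on $T^*G$ (induced by local coordinates on $G$), and $dh(g,\mu)\cdot(\delta g,\delta\mu)=\langle D_gh,\delta g\rangle+\langle\delta\mu,D_\mu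 h\rangle$ with $D_gh\in T_g^*G$, $D_\mu h\in\mathfrak g$. For $\xi\in\mathfrak g$, $\mathrm{ad}_\xi\eta=[\xi,\eta]$ and $\mathrm{ad}_\xi^*$ is its dual: $\langle\mathrm{ad}^*_\xi\mu,\eta\rangle=\langle\mu,\mathrm{ad}_\xi\eta\rangle$. A variation of a curve is the derivative at $\epsilon=0$ of a smooth one-parameter family of curves equal to the given curve at $\epsilon=0$, and $\delta S$, $\delta s$ denote the corresponding derivatives of the actions. Fixing the terminal covector, written $\delta p(T)=0$, is understood through the left trivialization, i.e. as fixing $\mu(T)=g(T)^*\cdot p(T)$, so that $\delta\mu(T)=0$; $\delta g(T)$ is unconstrained. *)

(* Defs.v *)
From HB Require Import structures.
From mathcomp Require Import all_boot all_order all_algebra.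
From mathcomp Require Import all_classical all_reals all_analysis.

Set Implicit Arguments.
Unset Strict Implicit.
Unset Printing Implicit Defensive.
Import Order.TTheory GRing.Theory Num.Theory.
Import numFieldNormedType.Exports.
Local Open Scope classical_set_scope.
Local Open Scope ring_scope.

(* C^oo on an open set, for V finite-dimensional: all iterated directional
   derivatives exist and are (Frechet) differentiable, hence continuous.  Only
   the germs of f at points of U matter. *)
Definition smooth_on (R : realType) (V W : normedModType R) (U : set V)
    (f : V -> W) : Prop :=
  forall (vs : seq V) (x : V), U x ->
    differentiable (foldr (fun v (h : V -> W) => 'D_v h) f vs) x.

Definition smooth_at (R : realType) (V W : normedModType R) (f : V -> W)
    (x : V) : Prop :=
  exists U : set V, [/\ open U, U x & smooth_on U f].

(* Local coordinates on M with values in R^n.  Both maps are total functions,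
   meaningful only on [cdom] and [cimg]. *)
Record chart (R : realType) (n : nat) (M : topologicalType) := Chart {
  cdom : set M ;
  cmap :> M -> 'rV[R]_n ;
  cinv : 'rV[R]_n -> M ;
  cmapK : forall x, cdom x -> cinv (cmap x) = x ;
  cdom_open : open cdom ;
  cimg_open : open (cmap @` cdom) ;
  cmap_continuous : forall x, cdom x -> {for x, continuous cmap} ;
  cinv_continuous : forall x, cdom x -> {for cmap x, continuous cinv}
}.

Definition cimg (R : realType) (n : nat) (M : topologicalType)
  (c : chart R n M) : set 'rV[R]_n := c @` cdom c.

(* Smooth manifold of dimension n; [atlas] is any smooth atlas, possibly the
   maximal one, and [chart_at x] is a distinguished chart of it around x. *)
HB.mixin Record isSmoothManifold (R : realType) (n : nat) M
    of Topological M := {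
  atlas : set (chart R n M) ;
  chart_at : M -> chart R n M ;
  chart_at_atlas : forall x, atlas (chart_at x) ;
  chart_at_dom : forall x, cdom (chart_at x) x ;
  atlas_compatible : forall c c', atlas c -> atlas c' ->
    smooth_on (c @` (cdom c `&` cdom c')) (c' \o cinv c) ;
  manifold_hausdorff : hausdorff_space M ;
  manifold_second_countable : @second_countable M
}.

#[short(type="smoothManifoldType")]
HB.structure Definition SmoothManifold (R : realType) (n : nat) :=
  {M of isSmoothManifold R n M & Topological M}.

Section Manifold.
Context {R : realType} {n : nat}.
Implicit Types M N : smoothManifoldType R n.

(* T_xM and T_x^*M are R^n and its dual, through the coordinates given by the
   distinguished chart at x; covectors are column matrices. *)
Definition tangent M (x : M) := 'rV[R]_n.
Definition cotangent M (x : M) := 'cV[R]_n.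

Definition pairing (p : 'cV[R]_n) (v : 'rV[R]_n) : R := (v *m p) 0 0.

Definition tangent_map M N (f : M -> N) (x : M) (v : tangent x) :
    tangent (f x) :=
  'd (chart_at (f x) \o f \o cinv (chart_at x)) (chart_at x x) v.

(* The dual of a linear map f, <dual_map f p, v> = <p, f v>. *)
Definition dual_map (f : 'rV[R]_n -> 'rV[R]_n) (p : 'cV[R]_n) : 'cV[R]_n :=
  lin1_mx f *m p.

(* Smoothness on a neighbourhood of v; continuity at v keeps f near v inside the
   domain of the chart.  A smooth curve on [0, T] is a map on R which is smooth
   in this sense at every t of [0, T], endpoints included, i.e. one given with a
   smooth extension across the endpoints; [velocity] is then two-sided. *)
Definition msmooth_at (V : normedModType R) M (f : V -> M) (v : V) : Prop :=
  {for v, continuous f} /\ smooth_at (chart_at (f v) \o f) v.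

Definition velocity M (c : R -> M) (t : R) : tangent (c t) :=
  derive1 (chart_at (c t) \o c) t.

(* Components of a tangent vector in the coordinates of an arbitrary chart. *)
Definition tcoord M (c : chart R n M) (x : M) (v : tangent x) : 'rV[R]_n :=
  'd (c \o cinv (chart_at x)) (chart_at x x) v.

(* [X, Y](x) = DY.X - DX.Y in the coordinates of the distinguished chart at x,
   so that [X, Y] f = X (Y f) - Y (X f). *)
Definition lie_bracket M (X Y : forall x : M, tangent x) (x : M) : tangent x :=
  let loc (Z : forall x : M, tangent x) (u : 'rV[R]_n) :=
    tcoord (chart_at x) (Z (cinv (chart_at x) u)) in
  'd (loc Y) (chart_at x x) (X x) - 'd (loc X) (chart_at x x) (Y x).

Record cotangent_bundle M := Covector {
  base : M ;
  covec : cotangent base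
}.

(* Canonical coordinates (q, p) on T^*M induced by local coordinates c on M:
   q = c(x), and <p, w> is the value of the covector on the tangent vector with
   components w in c. *)
Definition canonical_q M (c : chart R n M) (z : cotangent_bundle M) :
    'rV[R]_n := c (base z).

Definition canonical_p M (c : chart R n M) (z : cotangent_bundle M) :
    'cV[R]_n :=
  'J (chart_at (base z) \o cinv c) (c (base z)) *m covec z.

Definition of_canonical M (c : chart R n M) (q : 'rV[R]_n) (p : 'cV[R]_n) :
    cotangent_bundle M :=
  let x := cinv c q in
  @Covector M x ('J (c \o cinv (chart_at x)) (chart_at x x) *m p).

Definition cotangent_smooth_at (V : normedModType R) M
    (f : V -> cotangent_bundle M) (v : V) : Prop :=
  msmooth_at (@base M \o f) v /\
  smooth_at (canonical_p (chart_at (base (f v))) \o f) v.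

Definition smooth_hamiltonian M (H : cotangent_bundle M -> R) : Prop :=
  forall c, atlas c ->
    smooth_on (cimg c `*` [set: 'cV[R]_n])
      (fun z : 'rV[R]_n * 'cV[R]_n => H (of_canonical c z.1 z.2) : R^o).

(* Derivatives of real functions as elements of the dual space: a row-vector
   variable gives a column, and a column-vector variable gives a row. *)
Definition grad (f : 'rV[R]_n -> R) (q : 'rV[R]_n) : 'cV[R]_n :=
  \col_i 'D_(delta_mx 0 i) (f : 'rV[R]_n -> R^o) q.

Definition cograd (f : 'cV[R]_n -> R) (p : 'cV[R]_n) : 'rV[R]_n :=
  \row_i 'D_(delta_mx i 0) (f : 'cV[R]_n -> R^o) p.

Definition hamilton_equations M (H : cotangent_bundle M -> R)
    (gamma : R -> cotangent_bundle M) (t : R) : Prop :=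
  forall c, atlas c -> cdom c (base (gamma t)) ->
    let q := canonical_q c \o gamma in
    let p := canonical_p c \o gamma in
    derive1 q t = cograd (fun p' => H (of_canonical c (q t) p')) (p t) /\
    derive1 p t = - grad (fun q' => H (of_canonical c q' (p t))) (q t).

End Manifold.

Arguments base {R n M} _.
Arguments covec {R n M} _.

HB.mixin Record isLieGroup (R : realType) (n : nat) G
    of Group G & SmoothManifold R n G := {
  mulg_smooth : forall a b : G,
    msmooth_at
      (fun u : 'rV[R]_n * 'rV[R]_n =>
        (cinv (chart_at a) u.1 * cinv (chart_at b) u.2)%g : G)
      (chart_at a a, chart_at b b) ;
  invg_smooth : forall a : G,
    msmooth_at (fun u : 'rV[R]_n => ((cinv (chart_at a) u)^-1)%g : G)
      (chart_at a a)
}.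

#[short(type="lieGroupType")]
HB.structure Definition LieGroup (R : realType) (n : nat) :=
  {G of isLieGroup R n G & Group G & SmoothManifold R n G}.

Section LieGroup.
Context {R : realType} {n : nat} {G : lieGroupType R n}.
Implicit Types (g : G).

Definition lie_algebra := tangent (1%g : G).
Definition dual_lie_algebra := cotangent (1%g : G).

(* T_{g 1}G is T_gG, and T_{g^-1 g}G is T_1G, since g 1 = g and g^-1 g = 1. *)
Definition ltrans g (xi : lie_algebra) : tangent g :=
  tangent_map (x := 1%g) (fun x : G => (g * x)%g) xi.

Definition ltrans_inv g (v : tangent g) : lie_algebra :=
  tangent_map (fun x : G => (g^-1 * x)%g) v.

Definition ltrans_dual g (p : cotangent g) : dual_lie_algebra :=
  dual_map (@ltrans g) p.

Definition ltrans_dual_inv g (mu : dual_lie_algebra) : cotangent g :=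
  invmx (lin1_mx (@ltrans g)) *m mu.

Definition ad (xi eta : lie_algebra) : lie_algebra :=
  lie_bracket (fun x => @ltrans x xi) (fun x => @ltrans x eta) 1%g.

Definition ad_dual (xi : lie_algebra) (mu : dual_lie_algebra) :
    dual_lie_algebra := dual_map (ad xi) mu.

Definition left_triv (z : cotangent_bundle G) : G * dual_lie_algebra :=
  (base z, ltrans_dual (covec z)).

Definition left_triv_hamiltonian (H : cotangent_bundle G -> R)
    (z : G * dual_lie_algebra) : R :=
  H (Covector (ltrans_dual_inv z.1 z.2)).

Definition triv_smooth_at (V : normedModType R)
    (f : V -> G * dual_lie_algebra) (v : V) : Prop :=
  msmooth_at (fst \o f) v /\ smooth_at (snd \o f : V -> 'cV[R]_n) v.

Definition action_integral (T : R) (H : cotangent_bundle G -> R)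
    (gamma : R -> cotangent_bundle G) : R :=
  \int[lebesgue_measure]_(t in `[0, T])
    (pairing (covec (gamma t)) (velocity (base \o gamma) t) - H (gamma t)).

Definition triv_action_integral (T : R) (h : G * dual_lie_algebra -> R)
    (z : R -> G * dual_lie_algebra) : R :=
  \int[lebesgue_measure]_(t in `[0, T])
    (pairing (z t).2 (ltrans_inv (velocity (fst \o z) t)) - h (z t)).

(* Smooth one-parameter families F eps t of curves over [0, T] that equal the
   given curve at eps = 0. *)
Definition cotangent_family (T : R) (gamma : R -> cotangent_bundle G)
    (F : R -> R -> cotangent_bundle G) : Prop :=
  (forall t, t \in `[0, T] -> F 0 t = gamma t) /\
  (\forall eps \near (0 : R), forall t, t \in `[0, T] ->
    cotangent_smooth_at (fun u : R * R => F u.1 u.2) (eps, t)).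

Definition triv_family (T : R) (z : R -> G * dual_lie_algebra)
    (F : R -> R -> G * dual_lie_algebra) : Prop :=
  (forall t, t \in `[0, T] -> F 0 t = z t) /\
  (\forall eps \near (0 : R), forall t, t \in `[0, T] ->
    triv_smooth_at (fun u : R * R => F u.1 u.2) (eps, t)).

Definition typeII_dAlembert (T : R) (H : cotangent_bundle G -> R)
    (gamma : R -> cotangent_bundle G) : Prop :=
  forall F : R -> R -> cotangent_bundle G, cotangent_family T gamma F ->
    let delta_g t : tangent (base (F 0 t)) :=
      velocity (fun eps => base (F eps t)) 0 in
    let delta_mu t : dual_lie_algebra :=
      derive1 (fun eps => (left_triv (F eps t)).2 : 'cV[R]_n) 0 in
    delta_g 0 = 0 -> delta_mu T = 0 ->
    is_derive (0 : R) (1 : R) (fun eps => action_integral T H (F eps) : R^o)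
      (pairing (covec (gamma T)) (delta_g T)).

Definition triv_typeII_dAlembert (T : R) (h : G * dual_lie_algebra -> R)
    (z : R -> G * dual_lie_algebra) : Prop :=
  forall F : R -> R -> G * dual_lie_algebra, triv_family T z F ->
    let eta t : lie_algebra :=
      ltrans_inv (velocity (fun eps => (F eps t).1) 0) in
    let delta_mu t : dual_lie_algebra :=
      derive1 (fun eps => (F eps t).2 : 'cV[R]_n) 0 in
    eta 0 = 0 -> delta_mu T = 0 ->
    is_derive (0 : R) (1 : R) (fun eps => triv_action_integral T h (F eps) : R^o)
      (pairing (z T).2 (eta T)).

Definition partial_g (h : G * dual_lie_algebra -> R) g
    (mu : dual_lie_algebra) : cotangent g :=
  grad (fun u => h (cinv (chart_at g) u, mu)) (chart_at g g).

Definition partial_mu (h : G * dual_lie_algebra -> R) g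
    (mu : dual_lie_algebra) : lie_algebra :=
  cograd (fun nu => h (g, nu)) mu.

Definition lie_poisson_equations (h : G * dual_lie_algebra -> R)
    (z : R -> G * dual_lie_algebra) (t : R) : Prop :=
  let g := (z t).1 in
  let mu := (z t).2 in
  velocity (fst \o z) t = ltrans g (partial_mu h g mu) /\
  derive1 (fun s => (z s).2 : 'cV[R]_n) t =
    - ltrans_dual (partial_g h g mu) + ad_dual (partial_mu h g mu) mu.

End LieGroup.

Arguments lie_algebra {R n} G.
Arguments dual_lie_algebra {R n} G.

(* Main.v *)
Require Import Defs.
From HB Require Import structures.
From mathcomp Require Import all_boot all_order all_algebra.
From mathcomp Require Import all_classical all_reals all_analysis.
From mathcomp Require Import ring lra.

Set Implicit Arguments.
Unset Strict Implicit.
Unset Printing Implicit Defensive.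
Import Order.TTheory GRing.Theory Num.Theory.
Import numFieldNormedType.Exports.
Local Open Scope classical_set_scope.
Local Open Scope ring_scope.

(** The theorem reduces to three equivalences, all relating to the curve
    [z = left_triv \o gamma], [z = (g, mu)], with [h] the left-trivialized
    Hamiltonian.

    The two variational principles are equivalent because left trivialization
    is a diffeomorphism of the cotangent bundle onto [G * dual_lie_algebra G]:
    it carries smooth families of curves to smooth families
    ([left_triv_smoothP]), and it preserves the action, the boundary conditions
    and the boundary term ([dAlembert_left_triv]).

    The trivialized principle is equivalent to the Lie-Poisson equations by the
    calculus of variations.  For a family of curves let [xi] and [eta] be the
    left logarithmic derivatives of its group component in [t] and in the
    parameter.  The mixed derivatives commute up to a bracket: the derivative of
    [xi] in the parameter is [eta' + [xi, eta]] ([maurer_cartan]).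
    Differentiating under the integral sign and integrating by parts,
    [first_variation] gives
    [delta s = <mu(T), eta(T)> + \int (<delta_mu, w1> + <w2, eta>)] with
    [w1 = xi - D_mu h] and [w2 = - mu' + ad^*_xi mu - g^* D_g h].  The
    Lie-Poisson equations say that [w1 = w2 = 0].  Conversely, [w1] and [w2] are
    smooth in [t], so [eta = t w2] and [delta_mu = (T - t) w1] is an admissible
    variation; it makes the integral of the nonnegative function
    [(T - t) |w1|^2 + t |w2|^2] vanish ([triv_dAlembert_lie_poisson]).

    Hamilton's equations in a chart [c] and the Lie-Poisson equations are
    equivalent pointwise.  With [L] the matrix of the left-invariant frame in
    [c], the momenta satisfy [mu = L p], so the Hamiltonian in canonical
    coordinates is [h (q, L(q) p)].  Differentiating, the terms containing the
    derivatives of [L] combine into [ad^*] by the structure equation of the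
    frame ([structure_equation], [hamilton_lie_poisson]).

    The structure equation, from which the Maurer-Cartan equation is also
    deduced, holds at the identity by the definition of the bracket, and left
    translation carries it to every other point, the second derivatives of the
    translation cancelling by their symmetry ([derive_sym_mx]).

    All of this rests on a calculus of maps that are smooth in the sense of
    iterated directional derivatives: the class is stable under composition,
    products and matrix operations. *)

(** * Derivatives *)

Section Derivatives.
Context {R : realType}.
Implicit Types U V W Z : normedModType R.

Lemma near_eq_differentiable V W (f g : V -> W) (x : V) :
  (\near x, f x = g x) -> differentiable f x -> differentiable g x.
Proof.
move=> fg df; apply/diff_locallyP.
have dfc := diff_continuous df; have dfE := diff_locally df.
have gE : g \o shift x = cst (g x) + 'd f x +o_ 0 id.
  apply/eqaddoP => e e0.
  have := dfE; rewrite -(nbhs_singleton fg) => /eqaddoP /(_ e e0) H.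
  near=> h.
  have -> : (g \o shift x - (cst (f x) + 'd f x)) h
    = (f \o shift x - (cst (f x) + 'd f x)) h.
    rewrite /= !fctE /=.
    have -> // : f (h + x) = g (h + x).
    near: h; have := fg; rewrite (near_shift 0) /= => H'.
    by apply: filterS H' => h /=; rewrite subr0.
  by near: h.
have [dgE] : 'd g x = 'd f x :> (V -> W) by exact: diff_unique.
by rewrite dgE.
Unshelve. all: by end_near. Qed.

Lemma derive_comp V W Z (f : V -> W) (g : W -> Z) x v :
  differentiable f x -> differentiable g (f x) ->
  'D_v (g \o f) x = 'D_('D_v f x) g (f x).
Proof.
move=> df dg; rewrite !deriveE//; last exact: differentiable_comp.
by rewrite diff_comp.
Qed.

Lemma derive_pair V W Z (f : V -> W) (g : V -> Z) x v :
  differentiable f x -> differentiable g x ->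
  'D_v (fun y => (f y, g y)) x = ('D_v f x, 'D_v g x).
Proof.
move=> df dg; rewrite !deriveE ?diff_pair//; exact: differentiable_pair.
Qed.

End Derivatives.

(** * Finite-dimensional spaces *)

(** Spaces with finitely many continuous linear coordinates: the setting in
    which the chain rule expresses a directional derivative of [g \o f] through
    derivatives of [g] in finitely many fixed directions. *)
Class findim {R : realType} (W : normedModType R) : Prop := FinDim {
  findim_basis : exists (m : nat) (e : 'I_m -> W) (l : 'I_m -> {linear W -> R^o}),
    (forall i, continuous (l i)) /\ forall w, w = \sum_i l i w *: e i }.

Global Instance findim_R (R : realType) : findim (R^o : normedModType R).
Proof.
split; exists 1%N, (fun=> 1), (fun=> idfun : {linear R^o -> R^o}); split.
  by move=> _ x; apply: cvg_id.
by move=> w; rewrite big_ord1 /= -[RHS]/(w * 1) mulr1.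
Qed.

Global Instance findim_mx (R : realType) m n :
  findim ('M[R]_(m, n) : normedModType R).
Proof.
pose I := [the finType of ('I_m * 'I_n)%type].
pose c (ij : I) (M : 'M[R]_(m, n)) : R^o := M ij.1 ij.2.
have clin ij : linear (c ij) by move=> a u v; rewrite /c !mxE.
pose l ij : {linear 'M[R]_(m, n) -> R^o} :=
  HB.pack (c ij) (GRing.isLinear.Build _ _ _ _ _ (clin ij)).
split; exists #|I|, (fun k => delta_mx (enum_val k).1 (enum_val k).2),
  (fun k => l (enum_val k)); split.
  by move=> i; exact: coord_continuous.
move=> w.
rewrite -(big_enum_val (A := I) (fun ij => l ij w *: delta_mx ij.1 ij.2)) /=.
rewrite {1}[w]matrix_sum_delta pair_big /=.
by apply: eq_big => //= i; rewrite inE.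
Qed.

Global Instance findim_prod (R : realType) (V W : normedModType R)
  {fV : findim V} {fW : findim W} : findim ((V * W)%type : normedModType R).
Proof.
have [m [e [l [lc le]]]] := @findim_basis _ _ fV.
have [n [f [k [kc kf]]]] := @findim_basis _ _ fW.
pose c (i : 'I_m + 'I_n) (z : (V * W)%type) : R^o :=
  match i with inl i => l i z.1 | inr j => k j z.2 end.
have clin i : linear (c i) by case: i => i a u v; rewrite /c linearP.
pose cl i : {linear (V * W)%type -> R^o} :=
  HB.pack (c i) (GRing.isLinear.Build _ _ _ _ _ (clin i)).
pose b (i : 'I_m + 'I_n) : (V * W)%type :=
  match i with inl i => (e i, 0) | inr j => (0, f j) end.
split; exists (m + n)%N, (fun i => b (fintype.split i)), (fun i => cl (fintype.split i)); split.
  move=> i; case: (fintype.split i) => j z /=.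
    by apply: continuous_comp; [exact: cvg_fst|exact: lc].
  by apply: continuous_comp; [exact: cvg_snd|exact: kc].
move=> [v w]; rewrite big_split_ord /=.
under eq_bigr do rewrite (unsplitK (inl _)) /=.
under [X in _ + X]eq_bigr do rewrite (unsplitK (inr _)) /=.
have E : forall z : V * W, (z.1, z.2) = z by case.
rewrite -[LHS]E -[RHS]E /= (raddf_sum fst)/= (raddf_sum fst) /= (raddf_sum snd) (raddf_sum snd) /=.
congr pair.
  rewrite [X in _ + X]big1 ?addr0; first exact: le.
  by move=> i _; rewrite scaler0.
rewrite [X in X + _]big1 ?add0r; first exact: kf.
by move=> i _; rewrite scaler0.
Qed.

(** * Maps with iterated directional derivatives *)

Section Ck.
Context {R : realType}.
Implicit Types U V W Z : normedModType R.

(** [smooth_on] read as the intersection over [k] of these predicates, which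
    are the ones that go through an induction: differentiating a sum, product
    or composite of [ck k.+1] maps gives sums and products of [ck k] maps. *)
Fixpoint ck V W (k : nat) (U : set V) (f : V -> W) : Prop :=
  (forall x, U x -> differentiable f x) /\
  (if k is k'.+1 then forall v, ck k' U ('D_v f) else True).

Lemma smooth_onP V W (U : set V) (f : V -> W) :
  smooth_on U f <-> forall k, ck k U f.
Proof.
split=> [sf k|cf].
  elim: k f sf => [|k IH] f sf; first by split=> // x Ux; exact: (sf [::]).
  split=> [x Ux|v]; first exact: (sf [::]).
  by apply: IH => vs x Ux; have := sf (rcons vs v) x Ux; rewrite foldr_rcons.
move=> vs; elim/last_ind: vs f cf => [|vs v IH] f cf x Ux.
  by case: (cf 0%N) => + _; exact.
rewrite foldr_rcons; apply: IH => // k.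
by case: (cf k.+1) => _ /(_ v).
Qed.

Lemma ck_diff V W k (U : set V) (f : V -> W) x :
  ck k U f -> U x -> differentiable f x.
Proof. by case: k => [|k] [+ _]; exact. Qed.

Lemma ckW V W k (U : set V) (f : V -> W) : ck k.+1 U f -> ck k U f.
Proof.
elim: k f => [|k IH] f [df Df]; split=> // v; exact/IH/Df.
Qed.

Lemma ckS V W k (A B : set V) (f : V -> W) : A `<=` B -> ck k B f -> ck k A f.
Proof.
move=> AB; elim: k f => [|k IH] f [df Df].
  by split=> // x /AB; exact: df.
by split=> [x /AB|v]; [exact: df|exact/IH/Df].
Qed.

Lemma eq_ck V W k (U : set V) (f g : V -> W) : open U ->
  (forall x, U x -> f x = g x) -> ck k U f -> ck k U g.
Proof.
move=> oU; elim: k f g => [|k IH] f g fg [df Df].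
  split=> // x Ux; apply: near_eq_differentiable (df _ Ux).
  by near=> y; apply: fg; near: y; exact: open_nbhs_nbhs.
split=> [x Ux|v].
  apply: near_eq_differentiable (df _ Ux).
  by near=> y; apply: fg; near: y; exact: open_nbhs_nbhs.
apply: IH (Df v) => x Ux; apply: near_eq_derive.
by near=> y; apply: fg; near: y; exact: open_nbhs_nbhs.
Unshelve. all: by end_near. Qed.

Lemma ck_cst V W k (U : set V) (a : W) : ck k U (cst a : V -> W).
Proof.
elim: k a => [|k IH] a; first by split=> // x _; exact: differentiable_cst.
split=> [x _|v]; first exact: differentiable_cst.
rewrite (_ : 'D_v _ = cst 0); first exact: IH.
by apply/funext => x; rewrite derive_cst.
Qed.

Lemma ck_lin V W k (U : set V) (l : {linear V -> W}) :
  continuous l -> ck k U l.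
Proof.
move=> lc; case: k => [|k]; first by split=> // x _; exact: linear_differentiable.
split=> [x _|v]; first exact: linear_differentiable.
rewrite (_ : 'D_v _ = cst (l v)); first exact: ck_cst.
apply/funext => x; rewrite deriveE ?diff_lin//; exact: linear_differentiable.
Qed.

Lemma ck_lin_comp V W Z k (U : set V) (f : V -> W) (l : {linear W -> Z}) :
  open U -> continuous l -> ck k U f -> ck k U (l \o f).
Proof.
move=> oU lc.
have dl y : differentiable l y by exact: linear_differentiable.
elim: k f => [|k IH] f [df Df].
  by split=> // x Ux; apply: differentiable_comp; [exact: df|exact: dl].
split=> [x Ux|v]; first by apply: differentiable_comp; [exact: df|exact: dl].
apply: (eq_ck oU _ (IH _ (Df v))) => x Ux.
by rewrite derive_comp//; [rewrite deriveE ?diff_lin|exact: df].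
Qed.

Lemma ckD V W k (U : set V) (f g : V -> W) :
  open U -> ck k U f -> ck k U g -> ck k U (f + g).
Proof.
move=> oU; elim: k f g => [|k IH] f g [df Df] [dg Dg].
  by split=> // x Ux; apply: differentiableD; [exact: df|exact: dg].
split=> [x Ux|v]; first by apply: differentiableD; [exact: df|exact: dg].
apply: (eq_ck oU _ (IH _ _ (Df v) (Dg v))) => x Ux.
by rewrite deriveD//; apply: diff_derivable; [exact: df|exact: dg].
Qed.

Lemma ck_sum V W k (U : set V) n (f : 'I_n -> V -> W) :
  open U -> (forall i, ck k U (f i)) -> ck k U (\sum_(i < n) f i).
Proof.
move=> oU cf; elim/big_ind: _ => //; first exact: ck_cst.
by move=> *; exact: ckD.
Qed.

Lemma ckM V k (U : set V) (f g : V -> R) :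
  open U -> ck k U f -> ck k U g -> ck k U (f * g).
Proof.
move=> oU; elim: k f g => [|k IH] f g cf cg.
  split=> // x Ux; apply: differentiableM; [exact: ck_diff cf Ux|exact: ck_diff cg Ux].
split=> [x Ux|v]; first by apply: differentiableM; [exact: ck_diff cf Ux|exact: ck_diff cg Ux].
have Df := cf.2 v; have Dg := cg.2 v.
apply: (eq_ck oU _ (ckD oU (IH _ _ (ckW cf) Dg) (IH _ _ (ckW cg) Df))).
move=> x Ux; rewrite deriveM//.
  exact/diff_derivable/(ck_diff cf Ux).
exact/diff_derivable/(ck_diff cg Ux).
Qed.

(** The directions in which [g] is differentiated in the chain rule vary with
    the point; in coordinates they become the fixed directions [e i], with
    smooth coefficients. *)
Lemma ck_comp_scalar V W {fW : findim W} k (U : set V) (U' : set W) (f : V -> W)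
    (g : W -> R) :
  open U -> (forall x, U x -> U' (f x)) -> ck k U f -> ck k U' g ->
  ck k U (g \o f).
Proof.
move=> oU fU; have [m [e [l [lc le]]]] := @findim_basis _ _ fW.
have dcomp k' f' g' x : ck k' U f' -> ck k' U' g' ->
    (forall x, U x -> U' (f' x)) -> U x -> differentiable (g' \o f' : V -> R) x.
  move=> cf cg fU' Ux; apply: differentiable_comp; first exact: ck_diff cf Ux.
  exact: ck_diff cg (fU' _ Ux).
elim: k g => [|k IH] g cf cg; first by split=> // x Ux; exact: dcomp cf cg fU Ux.
split=> [x Ux|v]; first exact: dcomp cf cg fU Ux.
have Df := cf.2 v.
have Dg i := cg.2 (e i).
have cS : ck k U (\sum_(i < m) ((l i \o 'D_v f) * ('D_(e i) g \o f))).
  apply: ck_sum => // i; apply: ckM => //.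
    exact: (ck_lin_comp oU (lc i) Df).
  by apply: IH (Dg i); exact: ckW.
apply: (eq_ck oU _ cS) => x Ux.
have df := ck_diff cf Ux; have dg := ck_diff cg (fU _ Ux).
rewrite derive_comp// fct_sumE [RHS]deriveE// [in RHS](le ('D_v f x)).
rewrite linear_sum; apply: eq_bigr => i _.
by rewrite linearZ -(deriveE _ dg).
Qed.

(** A map into a finite-dimensional space is recovered from its coordinates. *)
Lemma ck_coords V W k (U : set V) (f : V -> W) m (e : 'I_m -> W)
    (l : 'I_m -> {linear W -> R^o}) : open U ->
  (forall w, w = \sum_i l i w *: e i) -> (forall i, ck k U (l i \o f)) ->
  ck k U f.
Proof.
move=> oU le; have fE : f = \sum_i (fun x => l i (f x) *: e i).
  by apply/funext => x; rewrite fct_sumE; exact: le.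
move=> cf; rewrite fE; apply: ck_sum => // i.
pose s (a : R^o) := a *: e i.
have slin : linear s by move=> a u v; rewrite /s scalerDl -scalerA.
pose sl : {linear R^o -> W} := HB.pack s (GRing.isLinear.Build _ _ _ _ _ slin).
have -> : (fun x => l i (f x) *: e i) = sl \o (l i \o f) by [].
apply: ck_lin_comp => //.
exact: scalel_continuous.
Qed.

Lemma ck_comp V W Z {fW : findim W} {fZ : findim Z} k (U : set V) (U' : set W)
    (f : V -> W) (g : W -> Z) :
  open U -> open U' -> (forall x, U x -> U' (f x)) -> ck k U f -> ck k U' g ->
  ck k U (g \o f).
Proof.
move=> oU oU' fU cf cg; have [m [e [l [lc le]]]] := @findim_basis _ _ fZ.
apply: (ck_coords oU le) => i.
apply: (@ck_comp_scalar _ _ _ _ _ _ _ (l i \o g) oU fU cf).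
exact: ck_lin_comp.
Qed.

End Ck.

(** * Smoothness at a point *)

Section SmoothAt.
Context {R : realType}.
Implicit Types V W Z : normedModType R.

Lemma ck_scalel V W k (U : set V) (c : V -> R) (w : W) : open U ->
  ck k U c -> ck k U (fun x => c x *: w).
Proof.
move=> oU cc; pose s (a : R^o) := a *: w.
have slin : linear s by move=> a u v; rewrite /s scalerDl -scalerA.
pose sl : {linear R^o -> W} := HB.pack s (GRing.isLinear.Build _ _ _ _ _ slin).
apply: (@ck_lin_comp _ _ _ _ _ _ c sl) => //; exact: scalel_continuous.
Qed.

Lemma ck_pair V W Z k (U : set V) (f : V -> W) (g : V -> Z) : open U ->
  ck k U f -> ck k U g -> ck k U (fun x => (f x, g x)).
Proof.
move=> oU; elim: k f g => [|k IH] f g cf cg.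
  split=> // x Ux; apply: differentiable_pair;
    [exact: ck_diff cf Ux|exact: ck_diff cg Ux].
split=> [x Ux|v].
  apply: differentiable_pair; [exact: ck_diff cf Ux|exact: ck_diff cg Ux].
apply: (eq_ck oU _ (IH _ _ (cf.2 v) (cg.2 v))) => x Ux.
by rewrite derive_pair//; [exact: ck_diff cf Ux|exact: ck_diff cg Ux].
Qed.

Lemma ck_mx V m n k (U : set V) (f : V -> 'M[R]_(m, n)) : open U ->
  (forall i j, ck k U (fun x => f x i j)) -> ck k U f.
Proof.
move=> oU cf.
have -> : f = \sum_i \sum_j (fun x => f x i j *: delta_mx i j).
  apply/funext => x; rewrite {1}[f x]matrix_sum_delta fct_sumE.
  by apply: eq_bigr => i _; rewrite fct_sumE.
by apply: ck_sum => // i; apply: ck_sum => // j; exact: ck_scalel.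
Qed.

Lemma near_open (T : topologicalType) (x : T) (P : T -> Prop) :
  (\forall y \near x, P y) ->
  exists A : set T, [/\ open A, A x & forall y, A y -> P y].
Proof.
move=> Px; have : nbhs x [set y | P y] := Px.
by rewrite nbhsE => -[A [oA Ax] AP]; exists A.
Qed.

Lemma open_near (T : topologicalType) (x : T) (A : set T) :
  open A -> A x -> \forall y \near x, A y.
Proof. by move=> oA Ax; exact: open_nbhs_nbhs. Qed.

Lemma smooth_at_ck V W (f : V -> W) x :
  smooth_at f x <-> exists U : set V, [/\ open U, U x & forall k, ck k U f].
Proof. by split=> -[U [oU Ux /smooth_onP sf]]; exists U. Qed.

Lemma eq_smooth_at V W (f g : V -> W) x :
  (\near x, f x = g x) -> smooth_at f x -> smooth_at g x.
Proof.
move=> /near_open[A [oA Ax Afg]] /smooth_at_ck[U [oU Ux cf]].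
apply/smooth_at_ck; exists (U `&` A); split=> [||k]; [exact: openI|by []|].
apply: (@eq_ck _ _ _ _ _ f); [exact: openI|by move=> y [_ /Afg]|].
by apply: ckS (cf k) => y [].
Qed.

Lemma ext_smooth_at V W (f g : V -> W) x :
  smooth_at f x -> (forall y, f y = g y) -> smooth_at g x.
Proof. by move=> sf /funext <-. Qed.

Lemma smooth_at_near V W (f : V -> W) x :
  smooth_at f x -> \forall y \near x, smooth_at f y.
Proof.
move=> [U [oU Ux sf]]; apply: filterS (open_near oU Ux) => y Uy.
by exists U.
Qed.

Lemma smooth_at_differentiable V W (f : V -> W) x :
  smooth_at f x -> differentiable f x.
Proof. by move=> [U [_ Ux sf]]; exact: (sf [::]). Qed.

Lemma smooth_at_derivable V W (f : V -> W) x v :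
  smooth_at f x -> derivable f x v.
Proof. by move=> /smooth_at_differentiable df; exact: diff_derivable. Qed.

Lemma smooth_at_continuous V W (f : V -> W) x :
  smooth_at f x -> {for x, continuous f}.
Proof. by move=> /smooth_at_differentiable/differentiable_continuous. Qed.

Lemma smooth_at_derive V W (f : V -> W) v x :
  smooth_at f x -> smooth_at ('D_v f) x.
Proof.
move=> /smooth_at_ck[U [oU Ux cf]]; apply/smooth_at_ck; exists U; split=> // k.
exact: (cf k.+1).2.
Qed.

Lemma smooth_at_cst V W (a : W) (x : V) : smooth_at (cst a) x.
Proof.
apply/smooth_at_ck; exists setT; split=> // [|k]; [exact: openT|exact: ck_cst].
Qed.

Lemma smooth_at_linear V W (l : {linear V -> W}) x :
  continuous l -> smooth_at l x.
Proof.
move=> lc; apply/smooth_at_ck; exists setT; split=> // [|k]; [exact: openT|].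
exact: ck_lin.
Qed.

Lemma smooth_at_id V (x : V) : smooth_at (fun y => y) x.
Proof.
apply: (@smooth_at_linear _ _ (idfun : {linear V -> V})) => y; exact: cvg_id.
Qed.

Lemma smooth_at_fst V W (z : V * W) : smooth_at fst z.
Proof.
have fl : linear (fst : V * W -> V) by [].
apply: (@smooth_at_linear _ _
  (HB.pack (fst : V * W -> V) (GRing.isLinear.Build _ _ _ _ _ fl))) => y.
exact: cvg_fst.
Qed.

Lemma smooth_at_snd V W (z : V * W) : smooth_at snd z.
Proof.
have fl : linear (snd : V * W -> W) by [].
apply: (@smooth_at_linear _ _
  (HB.pack (snd : V * W -> W) (GRing.isLinear.Build _ _ _ _ _ fl))) => y.
exact: cvg_snd.
Qed.

Lemma smooth_at_comp V W Z {fW : findim W} {fZ : findim Z} (f : V -> W)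
    (g : W -> Z) x :
  smooth_at f x -> smooth_at g (f x) -> smooth_at (g \o f) x.
Proof.
move=> sf /smooth_at_ck[U' [oU' Ux' cg]].
have [U [oU Ux cf]] := (smooth_at_ck f x).1 sf.
have fU' : \forall y \near x, U' (f y).
  by apply: (smooth_at_continuous sf); exact: open_nbhs_nbhs.
have [A [oA Ax AU]] := near_open fU'.
apply/smooth_at_ck; exists (U `&` A); split=> [||k]; [exact: openI|by []|].
apply: (@ck_comp _ _ _ _ _ _ _ _ U') => //; first exact: openI.
  by move=> y [_ /AU].
by apply: ckS (cf k) => y [].
Qed.

Lemma smooth_at_join V W Z (f : V -> W) (g : V -> Z) x :
  smooth_at f x -> smooth_at g x ->
  exists U : set V, [/\ open U, U x, forall k, ck k U f & forall k, ck k U g].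
Proof.
move=> /smooth_at_ck[A [oA Ax cf]] /smooth_at_ck[B [oB Bx cg]].
exists (A `&` B); split=> // [|k|k]; first exact: openI.
  by apply: ckS (cf k) => y [].
by apply: ckS (cg k) => y [].
Qed.

Lemma smooth_at_pair V W Z (f : V -> W) (g : V -> Z) x :
  smooth_at f x -> smooth_at g x -> smooth_at (fun y => (f y, g y)) x.
Proof.
move=> sf sg; have [U [oU Ux cf cg]] := smooth_at_join sf sg.
by apply/smooth_at_ck; exists U; split=> // k; exact: ck_pair.
Qed.

Lemma smooth_atD V W (f g : V -> W) x :
  smooth_at f x -> smooth_at g x -> smooth_at (fun y => f y + g y) x.
Proof.
move=> sf sg; have [U [oU Ux cf cg]] := smooth_at_join sf sg.
by apply/smooth_at_ck; exists U; split=> // k; exact: ckD.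
Qed.

Lemma smooth_atM V (f g : V -> R) x :
  smooth_at f x -> smooth_at g x -> smooth_at (fun y => f y * g y) x.
Proof.
move=> sf sg; have [U [oU Ux cf cg]] := smooth_at_join sf sg.
by apply/smooth_at_ck; exists U; split=> // k; exact: ckM.
Qed.

Lemma smooth_at_mx V m n (f : V -> 'M[R]_(m, n)) x :
  smooth_at f x <-> forall i j, smooth_at (fun y => f y i j) x.
Proof.
split=> [sf i j|sf].
  have cl : linear (fun M : 'M[R]_(m, n) => M i j : R^o).
    by move=> a u v; rewrite !mxE.
  apply: (@smooth_at_comp _ _ _ _ _ f
    (HB.pack (fun M : 'M[R]_(m, n) => M i j : R^o)
      (GRing.isLinear.Build _ _ _ _ _ cl) : {linear 'M[R]_(m, n) -> R^o})) => //.
  by apply: smooth_at_linear; exact: coord_continuous.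
pose U i j := projT1 (cid ((smooth_at_ck _ _).1 (sf i j))).
have UP i j : [/\ open (U i j), U i j x & forall k, ck k (U i j) (fun y => f y i j)].
  by rewrite /U; case: cid.
have : \forall y \near x, forall i j, U i j y.
  apply: filter_forall => i; apply: filter_forall => j.
  by have [oU Ux _] := UP i j; exact: open_nbhs_nbhs.
move=> /near_open[A [oA Ax AU]].
apply/smooth_at_ck; exists A; split=> // k; apply: ck_mx => // i j.
by have [_ _ /(_ k)] := UP i j; apply: ckS => y /AU.
Qed.

Lemma smooth_at_sum V (I : Type) (r : seq I) (f : I -> V -> R) x :
  (forall i, smooth_at (f i) x) -> smooth_at (fun y => \sum_(i <- r) f i y) x.
Proof.
move=> sf; elim: r => [|i r IH].
  rewrite (_ : (fun _ => _) = cst 0); first exact: smooth_at_cst.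
  by apply/funext => y; rewrite big_nil.
rewrite (_ : (fun _ => _) = (fun y => f i y + \sum_(i <- r) f i y)).
  exact: smooth_atD.
by apply/funext => y; rewrite big_cons.
Qed.

Lemma smooth_at_mulmx V m n p (A : V -> 'M[R]_(m, n)) (B : V -> 'M[R]_(n, p)) x :
  smooth_at A x -> smooth_at B x -> smooth_at (fun y => A y *m B y) x.
Proof.
move=> /smooth_at_mx sA /smooth_at_mx sB; apply/smooth_at_mx => i j.
rewrite (_ : (fun _ => _) = (fun y => \sum_k A y i k * B y k j)).
  by apply: smooth_at_sum => k; apply: smooth_atM.
by apply/funext => y; rewrite mxE.
Qed.

Lemma smooth_atZ V m n (c : V -> R) (A : V -> 'M[R]_(m, n)) x :
  smooth_at c x -> smooth_at A x -> smooth_at (fun y => c y *: A y) x.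
Proof.
move=> sc /smooth_at_mx sA; apply/smooth_at_mx => i j.
rewrite (_ : (fun _ => _) = (fun y => c y * A y i j)); first exact: smooth_atM.
by apply/funext => y; rewrite mxE.
Qed.

Lemma smooth_at_trmx V m n (A : V -> 'M[R]_(m, n)) x :
  smooth_at A x -> smooth_at (fun y => (A y)^T) x.
Proof.
move=> /smooth_at_mx sA; apply/smooth_at_mx => i j.
rewrite (_ : (fun _ => _) = (fun y => A y j i))//.
by apply/funext => y; rewrite mxE.
Qed.

Lemma derive_mulmx V m n p (A : V -> 'M[R]_(m, n)) (B : V -> 'M[R]_(n, p)) x v :
  smooth_at A x -> smooth_at B x ->
  'D_v (fun y => A y *m B y) x = 'D_v A x *m B x + A x *m 'D_v B x.
Proof.
move=> sA sB; have sAB := smooth_at_mulmx sA sB.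
have dv W (f : V -> W) (sf : smooth_at f x) := @smooth_at_derivable _ _ f x v sf.
rewrite (derive_mx (dv _ _ sAB)) (derive_mx (dv _ _ sA)) (derive_mx (dv _ _ sB)).
apply/matrixP => i j; rewrite !mxE.
have -> : (fun y => (A y *m B y) i j) =
    \sum_k ((fun y => A y i k) * (fun y => B y k j)).
  by apply/funext => y; rewrite fct_sumE mxE.
have dA k : derivable (fun y => A y i k) x v.
  by apply: dv; exact: (smooth_at_mx A x).1.
have dB k : derivable (fun y => B y k j) x v.
  by apply: dv; exact: (smooth_at_mx B x).1.
rewrite derive_sum; last by move=> k; exact: derivableM.
rewrite -big_split; apply: eq_bigr => k _ /=.
by rewrite deriveM// !mxE [RHS]addrC; congr (_ + _); exact: mulrC.
Qed.

Lemma derive_mulmxl V m p (w : 'rV[R]_m) (A : V -> 'M[R]_(m, p)) v x :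
  smooth_at A x -> 'D_v (fun y => w *m A y) x = w *m 'D_v A x.
Proof.
move=> sA; rewrite (derive_mulmx v (smooth_at_cst w x) sA).
by rewrite derive_cst mul0mx add0r.
Qed.

Lemma derive_mulmxr V m p k (w : 'M[R]_(p, k)) (A : V -> 'M[R]_(m, p)) v x :
  smooth_at A x -> 'D_v (fun y => A y *m w) x = 'D_v A x *m w.
Proof.
move=> sA; rewrite (derive_mulmx v sA (smooth_at_cst w x)).
by rewrite derive_cst mulmx0 addr0.
Qed.

Lemma derive_entry V m n (A : V -> 'M[R]_(m, n)) x v i j :
  smooth_at A x -> 'D_v (fun y => A y i j) x = 'D_v A x i j.
Proof. by move=> sA; rewrite (derive_mx (@smooth_at_derivable _ _ A x v sA)) mxE.
Qed.

End SmoothAt.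

(** * Symmetry of second derivatives *)

Section Schwarz.
Context {R : realType}.
Implicit Types V W Z : normedModType R.

(** The second difference quotient of [f] in the directions [v] and [w] is
    symmetric in them; by the mean value theorem along [v] it tends to
    ['D_w ('D_v f) x], which is therefore symmetric as well. *)
Lemma second_difference V (f : V -> R) x v w : smooth_at f x ->
  (fun h : R => h ^- 2 * (f (h *: v + h *: w + x) - f (h *: v + x)
    - (f (h *: w + x) - f x))) @ 0^' --> 'D_w ('D_v f : V -> R) x.
Proof.
move=> sf; set F : V -> R := 'D_v f.
have dF : differentiable F x by exact/smooth_at_differentiable/smooth_at_derive.
have [r r0 Br] : exists2 r : R, 0 < r & forall y, `|y| < r -> differentiable f (y + x).
  have /nbhs_ballP[r r0 Hr] := smooth_at_near sf.
  exists r => // y yr; apply: smooth_at_differentiable; apply: Hr.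
  by rewrite -ball_normE /= opprD addrC addrNK normrN.
(* [`|h| * C] bounds the increments [a s] and [b s] below and their sum. *)
pose C := `|v| + `|w| + `|v| + 1; have C0 : 0 < C by rewrite ltr_wpDl ?addr_ge0.
apply/cvgrPdist_le => e e0.
have eC : 0 < e / C by rewrite divr_gt0.
have /eqaddoP /(_ _ eC) := diff_locally dF.
move=> /nbhs_normP[d d0 Hd].
have {}Hd y : `|y| < d -> `|F (y + x) - (F x + 'd F x y)| <= e / C * `|y|.
  by move=> yd; have := Hd y; rewrite /= sub0r normrN; exact.
near=> h.
have h0 : h != 0 by near: h; exact: nbhs_dnbhs_neq.
have hn0 : 0 < `|h| by rewrite normr_gt0.
have hr : `|h| * C < r.
  rewrite -ltr_pdivlMr//; near: h; apply: dnbhs0_lt; exact: divr_gt0.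
have hd : `|h| * C < d.
  rewrite -ltr_pdivlMr//; near: h; apply: dnbhs0_lt; exact: divr_gt0.
pose a s := (s * h) *: v + h *: w; pose b s := (s * h) *: v.
have bs (s : R) : s \in `[0, 1]%R -> `|b s| <= `|h| * `|v|.
  rewrite in_itv /= => /andP[s0 s1]; rewrite /b normrZ normrM (ger0_norm s0).
  by rewrite -mulrA ler_piMl ?mulr_ge0.
have as_ (s : R) : s \in `[0, 1]%R -> `|a s| <= `|h| * (`|v| + `|w|).
  move=> s01; rewrite (le_trans (ler_normD _ _))// mulrDr.
  by apply: lerD; [exact: bs|rewrite normrZ].
have asC (s : R) : s \in `[0, 1]%R -> `|a s| <= `|h| * C.
  move=> /as_ /le_trans; apply; rewrite ler_wpM2l// /C -addrA lerDl.
  by rewrite addr_ge0.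
have bsC (s : R) : s \in `[0, 1]%R -> `|b s| <= `|h| * C.
  move=> /bs /le_trans; apply; rewrite ler_wpM2l// /C -!addrA lerDl.
  by rewrite !addr_ge0.
pose phi s := f (a s + x) - f (b s + x).
have dphi (s : R) : s \in `[0, 1]%R ->
    is_derive s 1 phi (h * (F (a s + x) - F (b s + x))).
  move=> s01.
  have line c : `|(s * h) *: v + c| <= `|h| * C ->
    is_derive s 1 (fun s : R => f ((s * h) *: v + c + x))
      (h * F ((s * h) *: v + c + x)).
    move=> sc.
    have dl : is_diff s (fun s : R => (s * h) *: v + c + x) (fun t => (t * h) *: v).
      rewrite (_ : (fun s : R => _) = (fun s : R => s *: (h *: v)) + cst (c + x)).
        apply: is_diff_eq; apply/funext => t; rewrite !fctE /= addr0.
        by rewrite scalerA.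
      by apply/funext => t; rewrite !fctE scalerA addrA.
    have df : differentiable f ((s * h) *: v + c + x).
      by apply: Br; exact: le_lt_trans sc hr.
    have dl' : differentiable (fun s : R => (s * h) *: v + c + x) s by [].
    apply: DeriveDef.
      by apply/derivable1_diffP; apply: (@differentiable_comp _ _ _ _ _ f).
    rewrite (@derive_comp _ _ _ _ (fun s : R => (s * h) *: v + c + x) f)//.
    rewrite [X in 'D_X f _]deriveE// diff_val mul1r /F !deriveE//.
    by rewrite linearZ.
  rewrite mulrBr; apply: is_deriveB.
    by apply: (line (h *: w)); exact: asC.
  have := line 0; rewrite addr0 => /(_ (bsC _ s01)).
  rewrite (_ : (fun s => f (_ + 0 + x)) = (fun s => f (b s + x)))//.
  by apply/funext => t; rewrite addr0.
have oo01 (s : R) : s \in `]0, 1[%R -> s \in `[0, 1]%R by exact: subset_itv_oo_cc.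
have [|s /oo01 s01] := @MVT _ phi
    (fun s => h * (F (a s + x) - F (b s + x))) 0 1 ltr01 (fun s H => dphi s (oo01 s H)).
  apply: derivable_within_continuous => s s01.
  by have [] := dphi s s01.
rewrite /phi /a /b mul1r mul0r scale0r !add0r subr0 mulr1 => ->.
rewrite -/(a s) -/(b s).
have Fa := Hd _ (le_lt_trans (asC _ s01) hd).
have Fb := Hd _ (le_lt_trans (bsC _ s01) hd).
have dab : 'd F x (a s) - 'd F x (b s) = h * 'D_w F x.
  have hw : a s - b s = h *: w by rewrite /a /b addrC addKr.
  by rewrite -linearB hw linearZ (deriveE _ dF).
have -> : 'D_w F x - h ^- 2 * (h * (F (a s + x) - F (b s + x))) =
  h^-1 * ((F (b s + x) - (F x + 'd F x (b s))) - (F (a s + x) - (F x + 'd F x (a s)))).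
  have -> : (F (b s + x) - (F x + 'd F x (b s))) - (F (a s + x) - (F x + 'd F x (a s)))
    = ('d F x (a s) - 'd F x (b s)) - (F (a s + x) - F (b s + x)).
    by rewrite !opprD !opprK; ring.
  rewrite dab; move: (F _ - F _) => D; move: ('D_w F x) => D'.
  by field.
rewrite normrM normfV ler_pdivrMl// (le_trans (ler_normB _ _))//.
rewrite (le_trans (lerD Fb Fa))// -mulrDr.
have ab : `|b s| + `|a s| <= `|h| * C.
  rewrite (le_trans (lerD (bs _ s01) (as_ _ s01)))// -mulrDr ler_wpM2l//.
  by rewrite /C [leLHS]addrC lerDl.
rewrite (le_trans (ler_wpM2l (ltW eC) ab))// mulrCA divfK//.
by rewrite gt_eqF.
Unshelve. all: by end_near. Qed.

Lemma derive_sym V (f : V -> R) x v w : smooth_at f x ->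
  'D_w ('D_v f : V -> R) x = 'D_v ('D_w f : V -> R) x.
Proof.
move=> sf; have vw := second_difference (v := v) (w := w) sf.
have := second_difference (v := w) (w := v) sf.
rewrite (_ : (fun h : R => _) = (fun h : R => h ^- 2 * (f (h *: v + h *: w + x)
  - f (h *: v + x) - (f (h *: w + x) - f x)))); last first.
  apply/funext => h; congr (_ * _); rewrite [h *: w + h *: v]addrC.
  by rewrite !opprB [LHS]addrACA [RHS]addrACA; congr (_ + _); exact: addrC.
move=> wv; apply: (cvg_unique _ vw wv); exact: norm_hausdorff.
Qed.

Lemma derive_sym_mx V m n (f : V -> 'M[R]_(m, n)) x v w : smooth_at f x ->
  'D_w ('D_v f) x = 'D_v ('D_w f) x.
Proof.
move=> sf; apply/matrixP => i j.
have D2 u u' : 'D_u ('D_u' f) x i j = 'D_u ('D_u' (fun y => f y i j) : V -> R) x.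
  rewrite -(derive_entry u i j (smooth_at_derive u' sf)).
  apply: near_eq_derive; near=> y; rewrite derive_entry//.
  near: y; exact: smooth_at_near.
have Ds := @derive_sym _ _ x v w ((smooth_at_mx f x).1 sf i j).
exact: (etrans (D2 w v) (etrans Ds (esym (D2 v w)))).
Unshelve. all: by end_near. Qed.

End Schwarz.

(** * Smooth maps into manifolds and Lie groups *)

Section ManifoldCalculus.
Context {R : realType} {n : nat}.
Implicit Types (M : smoothManifoldType R n) (V W : normedModType R).

Lemma cdom_near M (c : chart R n M) x :
  cdom c x -> \forall y \near x, cdom c y.
Proof. exact/open_near/cdom_open. Qed.

Lemma cinv_cdom M (c : chart R n M) q : cimg c q -> cdom c (cinv c q).
Proof. by move=> [x cx <-]; rewrite cmapK. Qed.

Lemma cmap_cinv M (c : chart R n M) q : cimg c q -> c (cinv c q) = q.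
Proof. by move=> [x cx <-]; rewrite cmapK. Qed.

Lemma cimg_near M (c : chart R n M) q :
  cimg c q -> \forall q' \near q, cimg c q'.
Proof. exact/open_near/cimg_open. Qed.

Lemma cdom_cimg M (c : chart R n M) x : cdom c x -> cimg c (c x).
Proof. by move=> cx; exists x. Qed.

Lemma transition_smooth M (c c' : chart R n M) x : atlas c -> atlas c' ->
  cdom c x -> cdom c' x -> smooth_at (c' \o cinv c) (c x).
Proof.
move=> ac ac' cx cx'; exists (c @` (cdom c `&` cdom c')).
split; [|by exists x|exact: atlas_compatible].
rewrite openE => _ [y [cy cy'] <-].
have cyI := cdom_cimg cy.
have nI := cimg_near cyI.
have nc : \forall q \near c y, cdom c' (cinv c q).
  by apply: (cinv_continuous cy); rewrite cmapK//; exact: cdom_near.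
rewrite /interior /=; near=> q.
have cq : cimg c q by near: q.
exists (cinv c q); last exact: cmap_cinv.
by split; [exact: cinv_cdom|near: q].
Unshelve. all: by end_near. Qed.

Lemma continuous_cdom_near (T : topologicalType) M (c : chart R n M) (f : T -> M) v :
  {for v, continuous f} -> cdom c (f v) -> \forall u \near v, cdom c (f u).
Proof. by move=> fc cf; apply: fc; exact: cdom_near. Qed.

Lemma msmooth_cdom_near V M (c : chart R n M) (f : V -> M) v :
  msmooth_at f v -> cdom c (f v) -> \forall u \near v, cdom c (f u).
Proof. by move=> [fc _]; exact: continuous_cdom_near. Qed.

(** Smoothness may be read in any chart of the atlas, not only in the
    distinguished one. *)
Lemma msmooth_chart V {fV : findim V} M (c : chart R n M) (f : V -> M) v :
  msmooth_at f v -> atlas c -> cdom c (f v) -> smooth_at (c \o f) v.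
Proof.
move=> sf ac cf; set c0 := chart_at (f v).
have c0f : cdom c0 (f v) by exact: chart_at_dom.
have : smooth_at ((c \o cinv c0) \o (c0 \o f)) v.
  apply: smooth_at_comp; first by case: sf.
  by apply: transition_smooth => //; exact: chart_at_atlas.
apply: eq_smooth_at; near=> u => /=; rewrite cmapK//.
near: u; exact: msmooth_cdom_near.
Unshelve. all: by end_near. Qed.

(** Staying in the domain of a chart near [v] gives back the continuity that
    [msmooth_at] requires, as [f] is then [cinv c \o (c \o f)]. *)
Lemma msmooth_intro V {fV : findim V} M (c : chart R n M) (f : V -> M) v :
  atlas c -> (\forall u \near v, cdom c (f u)) -> smooth_at (c \o f) v ->
  msmooth_at f v.
Proof.
move=> ac cf sf; have cfv := nbhs_singleton cf.
split.
  have fE : \forall u \near v, (cinv c \o (c \o f)) u = f u.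
    by near=> u; rewrite /= cmapK//; near: u.
  rewrite /prop_for /continuous_at -(nbhs_singleton fE).
  apply: (cvg_trans (near_eq_cvg fE)).
  apply: continuous_comp; first exact: smooth_at_continuous.
  exact: cinv_continuous.
set c0 := chart_at (f v).
have : smooth_at ((c0 \o cinv c) \o (c \o f)) v.
  apply: smooth_at_comp => //.
  by apply: transition_smooth => //; [exact: chart_at_atlas|exact: chart_at_dom].
apply: eq_smooth_at; near=> u => /=; rewrite cmapK//; near: u; exact: cf.
Unshelve. all: by end_near. Qed.

Lemma eq_msmooth V {fV : findim V} M (f g : V -> M) v :
  (\near v, f v = g v) -> msmooth_at f v -> msmooth_at g v.
Proof.
move=> fg sf; have fgv := nbhs_singleton fg.
have c0f : cdom (chart_at (f v)) (f v) by exact: chart_at_dom.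
apply: (@msmooth_intro _ _ _ (chart_at (f v))); first exact: chart_at_atlas.
  near=> u; have -> : g u = f u by apply/esym; near: u.
  by near: u; exact: msmooth_cdom_near.
by apply: eq_smooth_at sf.2; near=> u => /=; congr (_ _); near: u.
Unshelve. all: by end_near. Qed.

Lemma msmooth_comp V W {fV : findim V} {fW : findim W} M (phi : V -> W)
    (f : W -> M) v :
  smooth_at phi v -> msmooth_at f (phi v) -> msmooth_at (f \o phi) v.
Proof.
move=> sphi [fc sf]; split.
  apply: continuous_comp => //; exact: smooth_at_continuous.
exact: (@smooth_at_comp _ _ _ _ _ _ phi (chart_at (f (phi v)) \o f)).
Qed.

Lemma msmooth_cst V {fV : findim V} M (x : M) (v : V) : msmooth_at (fun=> x) v.
Proof. split; [exact: cvg_cst|exact: smooth_at_cst]. Qed.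

Lemma msmooth_cinv M (c : chart R n M) q :
  atlas c -> cimg c q -> msmooth_at (cinv c) q.
Proof.
move=> ac cq; apply: (@msmooth_intro _ _ _ c) => //.
  by apply: filterS (cimg_near cq) => q'; exact: cinv_cdom.
apply: eq_smooth_at (smooth_at_id q).
by apply: filterS (cimg_near cq) => q' cq' /=; rewrite cmap_cinv.
Qed.

Lemma msmooth_near V {fV : findim V} M (f : V -> M) v :
  msmooth_at f v -> \forall u \near v, msmooth_at f u.
Proof.
move=> sf; set c := chart_at (f v).
have c0f : cdom c (f v) by exact: chart_at_dom.
have cf := msmooth_cdom_near sf c0f.
have [A [oA Av AP]] := near_open cf.
have sc := smooth_at_near sf.2; near=> u.
apply: (@msmooth_intro _ _ _ c); first exact: chart_at_atlas.
  have Au : A u by near: u; exact: open_near.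
  by apply: filterS AP (open_near oA Au).
by near: u.
Unshelve. all: by end_near. Qed.

(** Components of tangent vectors transform by the Jacobian matrix of the
    transition map. *)
Lemma derive_change_chart V {fV : findim V} M (c c' : chart R n M) (f : V -> M)
    v w : msmooth_at f v -> atlas c -> atlas c' -> cdom c (f v) ->
  cdom c' (f v) ->
  'D_w (c' \o f) v = 'D_w (c \o f) v *m 'J (c' \o cinv c) (c (f v)).
Proof.
move=> sf ac ac' cf cf'.
have ds : differentiable (c' \o cinv c) (c (f v)).
  exact/smooth_at_differentiable/transition_smooth.
have -> : 'D_w (c' \o f) v = 'D_w ((c' \o cinv c) \o (c \o f)) v.
  apply: near_eq_derive; near=> u => /=; rewrite cmapK//; near: u.
  exact: msmooth_cdom_near.
rewrite derive_comp ?deriveEjacobian//.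
exact/smooth_at_differentiable/msmooth_chart.
Unshelve. all: by end_near. Qed.

End ManifoldCalculus.

Section LieGroupCalculus.
Context {R : realType} {n : nat} {G : lieGroupType R n}.
Implicit Types (V W : normedModType R) (g x y : G) (c : chart R n G).

Lemma msmooth_mul V {fV : findim V} (f f' : V -> G) v :
  msmooth_at f v -> msmooth_at f' v -> msmooth_at (fun u => f u * f' u)%g v.
Proof.
move=> sf sf'; set a := chart_at (f v); set b := chart_at (f' v).
have af : cdom a (f v) by exact: chart_at_dom.
have bf : cdom b (f' v) by exact: chart_at_dom.
have /(_ fV _) := msmooth_comp (phi := fun u => (a (f u), b (f' u)))
  (smooth_at_pair sf.2 sf'.2) (mulg_smooth (f v) (f' v)).
apply: eq_msmooth; near=> u => /=; rewrite !cmapK//; near: u;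
  exact: msmooth_cdom_near.
Unshelve. all: by end_near. Qed.

Lemma msmooth_invg V {fV : findim V} (f : V -> G) v :
  msmooth_at f v -> msmooth_at (fun u => (f u)^-1)%g v.
Proof.
move=> sf; set a := chart_at (f v).
have af : cdom a (f v) by exact: chart_at_dom.
have /(_ fV _) := msmooth_comp (phi := a \o f) sf.2 (invg_smooth (f v)).
apply: eq_msmooth; near=> u => /=; rewrite !cmapK//; near: u;
  exact: msmooth_cdom_near.
Unshelve. all: by end_near. Qed.

End LieGroupCalculus.

(** * Left-invariant frames *)

Section Jacobians.
Context {R : realType}.
Implicit Types V W Z : normedModType R.

Lemma derive_partial2 V W Z (F : V * W -> Z) u x w :
  'D_w (fun y => F (u, y)) x = 'D_(0, w) F (u, x).
Proof.
rewrite /derive; set f1 := (fun _ : R => _); set f2 := (fun _ : R => _).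
suff -> : f1 = f2 by [].
apply/funext => h; rewrite /f1 /f2 /=; congr (_ *: (F _ - _)).
by rewrite -[RHS]/(h *: 0 + u, h *: w + x) scaler0 add0r.
Qed.

Lemma derive_partial1 V W Z (F : V * W -> Z) x u v :
  'D_v (fun y => F (y, u)) x = 'D_(v, 0) F (x, u).
Proof.
rewrite /derive; set f1 := (fun _ : R => _); set f2 := (fun _ : R => _).
suff -> : f1 = f2 by [].
apply/funext => h; rewrite /f1 /f2 /=; congr (_ *: (F _ - _)).
by rewrite -[RHS]/(h *: v + x, h *: 0 + u) scaler0 add0r.
Qed.

Lemma mulmx_rV_inj m n (A B : 'M[R]_(m, n)) :
  (forall w : 'rV_m, w *m A = w *m B) -> A = B.
Proof. by move=> AB; apply/row_matrixP => i; rewrite !rowE. Qed.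

Lemma jacobianE m n (f : 'rV[R]_m -> 'rV[R]_n) x i j :
  differentiable f x -> 'J f x i j = 'D_(delta_mx 0 i) f x 0 j.
Proof. by move=> df; rewrite deriveE// !mxE. Qed.

Lemma smooth_at_jacobian m n (f : 'rV[R]_m -> 'rV[R]_n) x :
  smooth_at f x -> smooth_at (jacobian f) x.
Proof.
move=> sf; apply/smooth_at_mx => i j.
have := (smooth_at_mx _ _).1 (smooth_at_derive (delta_mx 0 i) sf) 0 j.
apply: eq_smooth_at; near=> y; rewrite jacobianE//.
by apply: smooth_at_differentiable; near: y; exact: (smooth_at_near sf).
Unshelve. all: by end_near. Qed.

End Jacobians.

Definition chart1 {R : realType} {n : nat} {G : lieGroupType R n} :
  chart R n G := chart_at (1%g : G).

Definition unit1 {R : realType} {n : nat} {G : lieGroupType R n} : 'rV[R]_n :=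
  @chart1 R n G 1%g.

(** The left-invariant frame at [g] in the coordinates [c], one row per basis
    vector of the Lie algebra; [lcoframe] is its inverse matrix.  Both are
    locked to keep unification from comparing the underlying limits. *)
HB.lock Definition lframe {R : realType} {n : nat} {G : lieGroupType R n}
    (c : chart R n G) (g : G) : 'M[R]_n :=
  'J (fun v => c (g * cinv chart1 v)%g) (@unit1 R n G).

HB.lock Definition lcoframe {R : realType} {n : nat} {G : lieGroupType R n}
    (c : chart R n G) (g : G) : 'M[R]_n :=
  'J (fun w => chart1 (g^-1 * cinv c w)%g) (c g).

Section Frames.
Context {R : realType} {n : nat} {G : lieGroupType R n}.
Implicit Types (V W : normedModType R) (g x y : G) (c : chart R n G).
Local Notation unit1 := (@unit1 R n G).
Local Notation chart1 := (@chart1 R n G).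

Lemma lframeE c g : lframe c g = 'J (fun v => c (g * cinv chart1 v)%g) unit1.
Proof. by rewrite unlock. Qed.

Lemma lcoframeE c g :
  lcoframe c g = 'J (fun w => chart1 (g^-1 * cinv c w)%g) (c g).
Proof. by rewrite unlock. Qed.

Lemma chart1_atlas : atlas chart1. Proof. exact: chart_at_atlas. Qed.
Lemma chart1_dom : cdom chart1 1%g. Proof. exact: chart_at_dom. Qed.
Lemma cinv_unit1 : cinv chart1 unit1 = 1%g.
Proof. by rewrite cmapK//; exact: chart1_dom. Qed.
Lemma unit1_cimg : cimg chart1 unit1.
Proof. exact/cdom_cimg/chart1_dom. Qed.
Hint Resolve chart1_atlas chart1_dom unit1_cimg : core.

Lemma msmooth_lmul g : msmooth_at (fun v => g * cinv chart1 v)%g unit1.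
Proof.
by apply: msmooth_mul; [exact: msmooth_cst|exact: msmooth_cinv].
Qed.

Lemma smooth_lmul c g : atlas c -> cdom c g ->
  smooth_at (fun v => c (g * cinv chart1 v)%g) unit1.
Proof.
move=> ac cg; apply: (@msmooth_chart _ _ _ _ _ c); [exact: msmooth_lmul|by []|].
by rewrite cinv_unit1 mulg1.
Qed.

Lemma smooth_ldiv c g : atlas c -> cdom c g ->
  smooth_at (fun w => chart1 (g^-1 * cinv c w)%g) (c g).
Proof.
move=> ac cg.
apply: (@msmooth_chart _ _ _ _ _ chart1 (fun w => g^-1 * cinv c w)%g) => //.
  apply: msmooth_mul; first exact: msmooth_cst.
  exact/msmooth_cinv/cdom_cimg.
by rewrite cmapK// mulVg.
Qed.

Lemma lframe_derive c g xi : atlas c -> cdom c g ->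
  'D_xi (fun v => c (g * cinv chart1 v)%g) unit1 = xi *m lframe c g.
Proof.
move=> ac cg; rewrite lframeE.
exact/deriveEjacobian/smooth_at_differentiable/smooth_lmul.
Qed.

(** The entries of the frame are partial derivatives in the second variable of
    a smooth function of [(u, v)], the multiplication read in charts. *)
Lemma lframe_smooth V {fV : findim V} (f : V -> G) v c : msmooth_at f v ->
  atlas c -> cdom c (f v) -> smooth_at (fun u => lframe c (f u)) v.
Proof.
move=> sf ac cf.
pose F (z : V * 'rV[R]_n) := c (f z.1 * cinv chart1 z.2)%g.
have sF : smooth_at F (v, unit1).
  apply: (@msmooth_chart _ _ _ _ _ c
    (fun z : V * 'rV[R]_n => f z.1 * cinv chart1 z.2)%g) => //; last first.
    by rewrite /= cinv_unit1 mulg1.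
  apply: msmooth_mul.
    by apply: (msmooth_comp (f := f)) => //; exact: smooth_at_fst.
  by apply: (msmooth_comp (f := cinv chart1)); [exact: smooth_at_snd|
    exact: msmooth_cinv].
apply/smooth_at_mx => i j.
have spair : smooth_at (fun u : V => (u, unit1)) v.
  by apply: smooth_at_pair; [exact: smooth_at_id|exact: smooth_at_cst].
have sD : smooth_at ('D_(0, delta_mx 0 i) F \o (fun u => (u, unit1))) v.
  by apply: smooth_at_comp => //; exact: smooth_at_derive.
have := (smooth_at_mx _ _).1 sD 0 j.
apply: eq_smooth_at; near=> u => /=.
rewrite -(derive_partial2 F) lframeE jacobianE//.
apply/smooth_at_differentiable/smooth_lmul => //.
by near: u; exact: msmooth_cdom_near.
Unshelve. all: by end_near. Qed.

Lemma lcoframe_smooth V {fV : findim V} (f : V -> G) v c : msmooth_at f v ->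
  atlas c -> cdom c (f v) -> smooth_at (fun u => lcoframe c (f u)) v.
Proof.
move=> sf ac cf.
pose F (z : V * 'rV[R]_n) := chart1 ((f z.1)^-1 * cinv c z.2)%g.
have sF : smooth_at F (v, c (f v)).
  apply: (@msmooth_chart _ _ _ _ _ chart1
    (fun z : V * 'rV[R]_n => (f z.1)^-1 * cinv c z.2)%g) => //; last first.
    by rewrite /= cmapK// mulVg.
  apply: msmooth_mul.
    apply: msmooth_invg.
    by apply: (msmooth_comp (f := f)) => //; exact: smooth_at_fst.
  apply: (msmooth_comp (f := cinv c)); first exact: smooth_at_snd.
  by apply: msmooth_cinv => //; exact: cdom_cimg.
apply/smooth_at_mx => i j.
have spair : smooth_at (fun u : V => (u, c (f u))) v.
  by apply: smooth_at_pair; [exact: smooth_at_id|exact: msmooth_chart].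
have sD : smooth_at ('D_(0, delta_mx 0 i) F \o (fun u => (u, c (f u)))) v.
  by apply: smooth_at_comp => //; exact: smooth_at_derive.
have := (smooth_at_mx _ _).1 sD 0 j.
apply: eq_smooth_at; near=> u => /=.
rewrite -(derive_partial2 F) lcoframeE jacobianE//.
apply/smooth_at_differentiable/smooth_ldiv => //.
by near: u; exact: msmooth_cdom_near.
Unshelve. all: by end_near. Qed.

(** The left translations by [g] and by [g^-1] are inverse to each other. *)
Lemma lframeK c g : atlas c -> cdom c g -> lframe c g *m lcoframe c g = 1%:M.
Proof.
move=> ac cg; apply: mulmx_rV_inj => w; rewrite mulmx1 mulmxA -lframe_derive//.
have dm := smooth_at_differentiable (smooth_lmul ac cg).
have dd := smooth_at_differentiable (smooth_ldiv ac cg).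
have cE : c (g * cinv chart1 unit1)%g = c g by rewrite cinv_unit1 mulg1.
rewrite lcoframeE -deriveEjacobian// -cE -derive_comp//; last by rewrite cE.
rewrite -[RHS](derive_id unit1 w); apply: near_eq_derive; near=> v => /=.
rewrite cmapK; last first.
  near: v; apply: (msmooth_cdom_near (msmooth_lmul g)).
  by rewrite cinv_unit1 mulg1.
rewrite mulKg cmap_cinv//; near: v; exact: cimg_near.
Unshelve. all: by end_near. Qed.

Lemma lcoframeK c g : atlas c -> cdom c g -> lcoframe c g *m lframe c g = 1%:M.
Proof. by move=> ac cg; apply: mulmx1C; exact: lframeK. Qed.

Lemma lframe_change c c' g : atlas c -> atlas c' -> cdom c g -> cdom c' g ->
  lframe c' g = lframe c g *m 'J (c' \o cinv c) (c g).
Proof.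
move=> ac ac' cg cg'; apply: mulmx_rV_inj => w.
rewrite mulmxA -[LHS]lframe_derive// -[X in X *m _]lframe_derive//.
have := @derive_change_chart _ _ _ _ _ c c' _ unit1 w (msmooth_lmul g) ac ac'.
by rewrite cinv_unit1 mulg1; exact.
Qed.

(** The derivative of [F] along a left-invariant direction does not depend on
    the chart in which it is computed. *)
Lemma derive_lframe W c g (F : G -> W) xi : atlas c -> cdom c g ->
  differentiable (F \o cinv c) (c g) ->
  'D_(xi *m lframe c g) (F \o cinv c) (c g)
    = 'D_xi (fun v => F (g * cinv chart1 v)%g) unit1.
Proof.
move=> ac cg dF; rewrite -lframe_derive//.
have dm := smooth_at_differentiable (smooth_lmul ac cg).
have cE : c (g * cinv chart1 unit1)%g = c g by rewrite cinv_unit1 mulg1.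
rewrite -cE -derive_comp ?cE//.
apply: near_eq_derive; near=> v => /=; rewrite cmapK//.
near: v; apply: (msmooth_cdom_near (msmooth_lmul g)).
by rewrite cinv_unit1 mulg1.
Unshelve. all: by end_near. Qed.

Lemma lin1_ltrans g : lin1_mx (@ltrans R n G g) = lframe (chart_at g) g.
Proof.
rewrite lframeE.
have : lin1_mx (@ltrans R n G g) =
  'J (fun v => chart_at (g * 1)%g (g * cinv chart1 v)%g) unit1 by [].
by rewrite mulg1.
Qed.

Lemma ltransE g xi : ltrans g xi = xi *m lframe (chart_at g) g.
Proof. by rewrite -lin1_ltrans mul_rV_lin1. Qed.

Lemma ltrans_invE g (v : tangent g) :
  ltrans_inv v = v *m lcoframe (chart_at g) g.
Proof.
have : ltrans_inv v = v *m 'J (fun w => chart_at (g^-1 * g)%g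
    (g^-1 * cinv (chart_at g) w)%g) (chart_at g g).
  by rewrite mul_rV_lin1.
by rewrite lcoframeE mulVg.
Qed.

Lemma tcoord_ltrans c g xi : atlas c -> cdom c g ->
  tcoord c (ltrans g xi) = xi *m lframe c g.
Proof.
move=> ac cg; rewrite /tcoord ltransE.
have ag : atlas (chart_at g) by exact: chart_at_atlas.
have cgg : cdom (chart_at g) g by exact: chart_at_dom.
by rewrite (lframe_change ag ac cgg cg) mulmxA mul_rV_lin1.
Qed.

Lemma ltransK g xi : ltrans_inv (ltrans g xi) = xi.
Proof.
rewrite ltrans_invE ltransE -mulmxA lframeK ?mulmx1//.
  exact: chart_at_atlas.
exact: chart_at_dom.
Qed.

Lemma ltrans_invK g (v : tangent g) : ltrans g (ltrans_inv v) = v.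
Proof.
rewrite ltransE ltrans_invE -mulmxA lcoframeK ?mulmx1//.
  exact: chart_at_atlas.
exact: chart_at_dom.
Qed.

End Frames.
#[global] Hint Resolve chart1_atlas chart1_dom unit1_cimg : core.

(** * The structure equation *)

Section StructureEquation.
Context {R : realType} {n : nat} {G : lieGroupType R n}.
Implicit Types (V W : normedModType R) (g x y : G) (c : chart R n G).
Local Notation unit1 := (@unit1 R n G).
Local Notation chart1 := (@chart1 R n G).

Lemma lframe_chart1_1 : lframe chart1 (1%g : G) = 1%:M.
Proof.
apply: mulmx_rV_inj => w; rewrite mulmx1 -[LHS]lframe_derive//.
rewrite -[RHS](derive_id unit1 w); apply: near_eq_derive; near=> v.
rewrite mul1g cmap_cinv//; near: v; exact: (cimg_near unit1_cimg).
Unshelve. all: by end_near. Qed.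

Lemma lframe_smooth_chart c g : atlas c -> cdom c g ->
  smooth_at (fun q => lframe c (cinv c q)) (c g).
Proof.
move=> ac cg; apply: lframe_smooth => //; last by rewrite cmapK.
exact/msmooth_cinv/cdom_cimg.
Qed.

Lemma lframe_smooth_unit : smooth_at (fun u => lframe chart1 (cinv chart1 u : G)) unit1.
Proof. exact: (@lframe_smooth_chart chart1 1%g). Qed.

(** In the coordinates of the distinguished chart at the identity, the
    left-invariant field of [xi] is the row [xi] of the frame. *)
Lemma adE (zeta xi : lie_algebra G) : ad zeta xi =
  xi *m 'D_zeta (fun u => lframe chart1 (cinv chart1 u : G)) unit1
  - zeta *m 'D_xi (fun u => lframe chart1 (cinv chart1 u : G)) unit1.
Proof.
have loc (z z' : lie_algebra G) :
    'd (fun u => tcoord chart1 (ltrans (cinv chart1 u : G) z)) unit1 z'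
      = z *m 'D_z' (fun u => lframe chart1 (cinv chart1 u : G)) unit1.
  have sA : smooth_at (fun u => z *m lframe chart1 (cinv chart1 u : G)) unit1.
    by apply: smooth_at_mulmx; [exact: smooth_at_cst|exact: lframe_smooth_unit].
  have E : \forall u \near unit1, z *m lframe chart1 (cinv chart1 u : G) =
      tcoord chart1 (ltrans (cinv chart1 u : G) z).
    near=> u; rewrite tcoord_ltrans//; apply: cinv_cdom.
    near: u; exact: (cimg_near unit1_cimg).
  rewrite -(derive_mulmxl z z' lframe_smooth_unit) -deriveE.
    by apply/esym/near_eq_derive.
  by apply: near_eq_differentiable (smooth_at_differentiable sA).
have l1 (z : lie_algebra G) : ltrans (1%g : G) z = z.
  by rewrite ltransE [lframe _ _]lframe_chart1_1 mulmx1.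
by rewrite /ad /lie_bracket l1 [X in _ - 'd _ _ X]l1; congr (_ - _); exact: loc.
Unshelve. all: by end_near. Qed.

(** Translating by [g * k] is translating by [k] and then by [g]; the second
    translation contributes its Jacobian matrix. *)
Lemma lframe_lmul c g : atlas c -> cdom c g -> \forall u \near unit1,
  lframe c (g * cinv chart1 u)%g = lframe chart1 (cinv chart1 u : G)
    *m 'J (fun v => c (g * cinv chart1 v)%g) u.
Proof.
move=> ac cg; set phi := fun v => c (g * cinv chart1 v)%g.
have sphi := smooth_at_near (smooth_lmul ac cg : smooth_at phi unit1).
near=> u.
have dphi : differentiable phi u.
  by apply: smooth_at_differentiable; near: u.
have cgk : cdom c (g * cinv chart1 u)%g.
  near: u; apply: (msmooth_cdom_near (msmooth_lmul g)).
  by rewrite cinv_unit1 mulg1.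
set k : G := cinv chart1 u; rewrite -/k in cgk.
have uI : cimg chart1 u by near: u; exact: (cimg_near unit1_cimg).
have kd : cdom chart1 k by exact: cinv_cdom.
have ku : chart1 k = u by exact: cmap_cinv.
apply: mulmx_rV_inj => w; rewrite mulmxA -[LHS]lframe_derive//.
rewrite -[X in X *m _]lframe_derive//.
have k1 : chart1 (k * cinv chart1 unit1)%g = u by rewrite cinv_unit1 mulg1.
have dk := smooth_at_differentiable (smooth_lmul chart1_atlas kd).
have dphi' := dphi; rewrite -k1 in dphi'.
have DE := derive_comp w dk dphi'; rewrite k1 in DE.
apply: (etrans _ (etrans DE (deriveEjacobian _ dphi))).
apply: near_eq_derive; near=> v => /=; rewrite /phi cmapK ?mulgA//.
near: v; apply: (msmooth_cdom_near (msmooth_lmul k)).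
by rewrite cinv_unit1 mulg1.
Unshelve. all: by end_near. Qed.

(** Structure equation: left translation by [g] reduces it to the identity
    element, where it defines the bracket; the second derivatives of the
    translation, being symmetric, cancel. *)
Lemma structure_equation c g (zeta xi : lie_algebra G) : atlas c -> cdom c g ->
  xi *m 'D_(zeta *m lframe c g) (fun q => lframe c (cinv c q)) (c g)
  - zeta *m 'D_(xi *m lframe c g) (fun q => lframe c (cinv c q)) (c g)
  = ad zeta xi *m lframe c g.
Proof.
move=> ac cg; set phi := fun v => c (g * cinv chart1 v)%g.
set X := fun q => lframe c (cinv c q); set A := fun u => lframe chart1 (cinv chart1 u : G).
have sphi : smooth_at phi unit1 by exact: smooth_lmul.
have sX : smooth_at X (c g) by exact: lframe_smooth_chart.
have sA : smooth_at A unit1 by exact: lframe_smooth_unit.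
have sJ : smooth_at (jacobian phi) unit1 by exact: smooth_at_jacobian.
have phi1 : phi unit1 = c g by rewrite /phi cinv_unit1 mulg1.
have A1 : A unit1 = 1%:M by rewrite /A cinv_unit1 lframe_chart1_1.
have J1 : jacobian phi unit1 = lframe c g by rewrite lframeE.
have key (z x : lie_algebra G) : x *m 'D_(z *m lframe c g) X (c g) =
    x *m 'D_z A unit1 *m lframe c g + 'D_z ('D_x phi) unit1.
  have D1 : 'D_(z *m lframe c g) X (c g) = 'D_z (X \o phi) unit1.
    have dX : differentiable X (phi unit1).
      by rewrite phi1; exact: smooth_at_differentiable.
    have E1 := derive_comp z (smooth_at_differentiable sphi) dX.
    have E2 : 'D_z phi unit1 = z *m lframe c g by exact: lframe_derive.
    by rewrite phi1 in E1; rewrite E2 in E1; exact: esym.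
  have D2 : 'D_z (X \o phi) unit1 = 'D_z (fun u => A u *m jacobian phi u) unit1.
    apply: near_eq_derive; near=> u => /=.
    rewrite /X /phi cmapK; last first.
      near: u; apply: (msmooth_cdom_near (msmooth_lmul g)).
      by rewrite cinv_unit1 mulg1.
    by near: u; exact: lframe_lmul.
  have D3 : x *m 'D_z (jacobian phi) unit1 = 'D_z ('D_x phi) unit1.
    rewrite -(derive_mulmxl x z sJ); apply: near_eq_derive; near=> u.
    apply/esym/deriveEjacobian/smooth_at_differentiable.
    by near: u; exact: (smooth_at_near sphi).
  have D4 := derive_mulmx z sA sJ; rewrite A1 J1 mul1mx in D4.
  apply: (etrans (congr1 (mulmx x) (etrans D1 (etrans D2 D4)))).
  by rewrite mulmxDr mulmxA; congr (_ + _); exact: D3.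
have S := @derive_sym_mx _ _ _ _ phi unit1 xi zeta sphi.
apply: (etrans (congr2 (fun a b => a - b) (key zeta xi) (key xi zeta))).
have cancel2 (U : zmodType) (a b s1 s2 : U) : s1 = s2 -> a + s1 - (b + s2) = a - b.
  by move=> ->; rewrite opprD addrACA subrr addr0.
apply: (etrans (cancel2 _ _ _ _ _ S)).
by rewrite adE mulmxBl.
Unshelve. all: by end_near. Qed.

End StructureEquation.

(** * Logarithmic derivatives and the Maurer-Cartan equation *)

(** The left logarithmic derivative [(f u)^-1 . D_w f u] of a map [f] into the
    group. *)
HB.lock Definition logd {R : realType} {n : nat} {G : lieGroupType R n}
    {V : normedModType R} (f : V -> G) (w : V) (u : V) : 'rV[R]_n :=
  'D_w (chart_at (f u) \o f) u *m lcoframe (chart_at (f u)) (f u).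

Section LogarithmicDerivative.
Context {R : realType} {n : nat} {G : lieGroupType R n}.
Implicit Types (V W : normedModType R) (g x y : G) (c : chart R n G).
Local Notation unit1 := (@unit1 R n G).
Local Notation chart1 := (@chart1 R n G).

Lemma logd_unlock V (f : V -> G) w u : logd f w u =
  'D_w (chart_at (f u) \o f) u *m lcoframe (chart_at (f u)) (f u).
Proof. by rewrite unlock. Qed.

Lemma lcoframe_change c c' g : atlas c -> atlas c' -> cdom c g -> cdom c' g ->
  'J (c' \o cinv c) (c g) *m lcoframe c' g = lcoframe c g.
Proof.
move=> ac ac' cg cg'.
rewrite -[LHS]mul1mx -(lcoframeK ac cg) -mulmxA [X in _ *m X]mulmxA.
by rewrite -lframe_change// lframeK// mulmx1.
Qed.

Lemma logd_chart V {fV : findim V} (f : V -> G) w u c :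
  msmooth_at f u -> atlas c -> cdom c (f u) ->
  logd f w u = 'D_w (c \o f) u *m lcoframe c (f u).
Proof.
move=> sf ac cf; rewrite logd_unlock.
have af : atlas (chart_at (f u)) by exact: chart_at_atlas.
have df : cdom (chart_at (f u)) (f u) by exact: chart_at_dom.
have := derive_change_chart w sf af ac df cf => ->.
by rewrite -mulmxA lcoframe_change.
Qed.

Lemma logd_lframe V {fV : findim V} (f : V -> G) w u c :
  msmooth_at f u -> atlas c -> cdom c (f u) ->
  logd f w u *m lframe c (f u) = 'D_w (c \o f) u.
Proof.
move=> sf ac cf.
by rewrite (logd_chart w sf ac cf) -mulmxA lcoframeK// mulmx1.
Qed.

Lemma logd_smooth V {fV : findim V} (f : V -> G) w u :
  msmooth_at f u -> smooth_at (logd f w) u.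
Proof.
move=> sf; set c := chart_at (f u).
have ac : atlas c by exact: chart_at_atlas.
have cf : cdom c (f u) by exact: chart_at_dom.
have cfn := msmooth_cdom_near sf cf.
have sfn : \forall y \near u, msmooth_at f y by exact: msmooth_near.
have sD : smooth_at ('D_w (c \o f)) u by exact/smooth_at_derive/msmooth_chart.
have sL : smooth_at (fun y : V => lcoframe c (f y)) u by exact: lcoframe_smooth.
apply: eq_smooth_at (smooth_at_mulmx sD sL); near=> y.
by apply/esym/logd_chart => //; near: y.
Unshelve. all: by end_near. Qed.

Lemma logd_partial2 V W (F : V * W -> G) u w (x : W) :
  logd (fun y : W => F (u, y)) w x = logd F (0, w) (u, x).
Proof.
rewrite !logd_unlock.
by have /= <- := derive_partial2 (chart_at (F (u, x)) \o F) u x w.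
Qed.

Lemma logd_partial1 V W (F : V * W -> G) u w (x : V) :
  logd (fun y : V => F (y, u)) w x = logd F (w, 0) (x, u).
Proof.
rewrite !logd_unlock.
by have /= <- := derive_partial1 (chart_at (F (x, u)) \o F) x u w.
Qed.

Lemma ltrans_inv_velocity (f : R -> G) t :
  ltrans_inv (velocity f t) = logd f 1 t.
Proof. by rewrite ltrans_invE logd_unlock /velocity derive1E. Qed.

Lemma velocity_ltransP (f : R -> G) t (zeta : lie_algebra G) :
  velocity f t = ltrans (f t) zeta <-> logd f 1 t = zeta.
Proof.
rewrite -ltrans_inv_velocity; split=> [->|<-]; first exact: ltransK.
by rewrite ltrans_invK.
Qed.

Lemma derive_lframe_along V {fV : findim V} (f : V -> G) w u c :
  msmooth_at f u -> atlas c -> cdom c (f u) ->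
  'D_w (fun y : V => lframe c (f y)) u =
    'D_(logd f w u *m lframe c (f u)) (fun q => lframe c (cinv c q)) (c (f u)).
Proof.
move=> sf ac cf; have cfn := msmooth_cdom_near sf cf.
have sq : smooth_at (c \o f) u by exact: msmooth_chart.
set X := fun p => lframe c (cinv c p).
have sX : smooth_at X ((c \o f) u) by exact: lframe_smooth_chart.
have E1 := derive_comp w (smooth_at_differentiable sq)
  (smooth_at_differentiable sX).
have E2 : 'D_w (c \o f) u = logd f w u *m lframe c (f u).
  by apply/esym/logd_lframe.
rewrite E2 in E1; apply: etrans E1; apply: near_eq_derive; near=> y.
by rewrite /X /= cmapK//; near: y.
Unshelve. all: by end_near. Qed.

(** Maurer-Cartan equation: the mixed derivatives of [c \o f] are equal, and
    expressing both through the frame leaves the structure equation. *)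
Lemma maurer_cartan V {fV : findim V} (f : V -> G) v w u : msmooth_at f u ->
  'D_v (logd f w) u - 'D_w (logd f v) u =
  ad (logd f w u : lie_algebra G) (logd f v u).
Proof.
move=> sf; set c := chart_at (f u).
have ac : atlas c by exact: chart_at_atlas.
have cf : cdom c (f u) by exact: chart_at_dom.
have cfn := msmooth_cdom_near sf cf.
have sfn : \forall y \near u, msmooth_at f y by exact: msmooth_near.
set q := c \o f; have sq : smooth_at q u by exact: msmooth_chart.
set L := fun y : V => lframe c (f y).
have sL : smooth_at L u by exact: lframe_smooth.
set X := fun p => lframe c (cinv c p).
have DL z : 'D_z L u = 'D_(logd f z u *m L u) X (q u).
  exact: derive_lframe_along.
have key z z' : 'D_z (logd f z') u *m L u
    + logd f z' u *m 'D_(logd f z u *m L u) X (q u) = 'D_z ('D_z' q) u.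
  have sl : smooth_at (logd f z') u by exact: logd_smooth.
  have E1 := derive_mulmx z sl sL.
  rewrite DL in E1; apply: etrans (esym E1) _; apply: near_eq_derive.
  by near=> y; apply: logd_lframe => //; near: y.
have S := @derive_sym_mx _ _ _ _ q u w v sq.
have := etrans (key v w) (etrans S (esym (key w v))).
have SE := structure_equation (logd f w u) (logd f v u) ac cf.
move: SE; rewrite -/X -/(L u) -/(q u).
move: ('D_(logd f w u *m L u) X (q u)) ('D_(logd f v u *m L u) X (q u)) => Dw Dv.
move: ('D_v (logd f w) u) ('D_w (logd f v) u) (ad _ _) => A B C SE AB.
have LK : L u *m lcoframe c (f u) = 1%:M by exact: lframeK.
rewrite -[LHS]mulmx1 -[RHS]mulmx1 -LK !mulmxA -SE mulmxBl; congr (_ *m _).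
apply/eqP; rewrite subr_eq addrAC eq_sym subr_eq; apply/eqP.
by rewrite addrC -AB addrC.
Unshelve. all: by end_near. Qed.

End LogarithmicDerivative.

(** * Functions on the trivialized cotangent bundle *)

Section TrivializedFunctions.
Context {R : realType} {n : nat} {G : lieGroupType R n}.
Implicit Types (V W : normedModType R) (g : G) (c : chart R n G).
Implicit Types (h : G * dual_lie_algebra G -> R).
Local Notation unit1 := (@unit1 R n G).
Local Notation chart1 := (@chart1 R n G).

Lemma gradE (f : 'rV[R]_n -> R) q v : differentiable f q ->
  'D_v f q = (v *m grad f q) 0 0.
Proof.
move=> df; rewrite mxE (deriveE _ df) {1}[v]row_sum_delta linear_sum.
by apply: eq_bigr => i _; rewrite linearZ mxE (deriveE _ df).
Qed.

Lemma cogradE (f : 'cV[R]_n -> R) p v : differentiable f p ->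
  'D_v f p = (cograd f p *m v) 0 0.
Proof.
move=> df; rewrite mxE (deriveE _ df) {1}[v]matrix_sum_delta linear_sum.
apply: eq_bigr => i _; rewrite big_ord1 linearZ mxE (deriveE _ df).
by rewrite mulrC.
Qed.

Lemma mulmx_cV_inj (A B : 'cV[R]_n) :
  (forall xi : 'rV_n, (xi *m A) 0 0 = (xi *m B) 0 0) -> A = B.
Proof.
move=> AB; apply: mulmx_rV_inj => xi.
by apply/matrixP => i j; rewrite !ord1; exact: AB.
Qed.

Definition triv_smooth_fun h := forall c g mu, atlas c -> cdom c g ->
  smooth_at (fun z : 'rV[R]_n * 'cV[R]_n => h (cinv c z.1, z.2)) (c g, mu).

Lemma ltrans_dualE g (p : cotangent g) : ltrans_dual p = lframe (chart_at g) g *m p.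
Proof. by rewrite /ltrans_dual /dual_map lin1_ltrans. Qed.

Lemma ltrans_dual_invE g (mu : dual_lie_algebra G) :
  ltrans_dual_inv g mu = lcoframe (chart_at g) g *m mu.
Proof.
rewrite /ltrans_dual_inv lin1_ltrans; congr (_ *m _).
have ag : atlas (chart_at g) by exact: chart_at_atlas.
have cg : cdom (chart_at g) g by exact: chart_at_dom.
have LK := lframeK ag cg; have [Lu _] := mulmx1_unit LK.
by rewrite -[LHS]mulmx1 -LK mulKmx.
Qed.

Lemma ltrans_dualK g (p : cotangent g) :
  ltrans_dual_inv g (ltrans_dual p) = p.
Proof.
rewrite ltrans_dual_invE ltrans_dualE mulmxA lcoframeK ?mul1mx//.
  exact: chart_at_atlas.
exact: chart_at_dom.
Qed.

Lemma ltrans_dual_invK g (mu : dual_lie_algebra G) :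
  ltrans_dual (ltrans_dual_inv g mu) = mu.
Proof.
rewrite ltrans_dualE ltrans_dual_invE mulmxA lframeK ?mul1mx//.
  exact: chart_at_atlas.
exact: chart_at_dom.
Qed.

Lemma left_triv_hamiltonianE (H : cotangent_bundle G -> R) c g
    (mu : dual_lie_algebra G) :
  atlas c -> cdom c g -> left_triv_hamiltonian H (g, mu) =
    H (of_canonical c (c g) (lcoframe c g *m mu)).
Proof.
move=> ac cg; rewrite /left_triv_hamiltonian /of_canonical /= cmapK//.
congr (H (Covector _)); rewrite ltrans_dual_invE mulmxA lcoframe_change//.
  exact: chart_at_atlas.
exact: chart_at_dom.
Qed.

(** [h (q, mu)] is [H] in canonical coordinates at [(q, L(q)^-1 mu)], where [L]
    is the left-invariant frame. *)
Lemma left_triv_hamiltonian_smooth (H : cotangent_bundle G -> R) :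
  smooth_hamiltonian H -> triv_smooth_fun (left_triv_hamiltonian H).
Proof.
move=> sH c g mu ac cg.
pose P (z : 'rV[R]_n * 'cV[R]_n) := (z.1, lcoframe c (cinv c z.1) *m z.2).
have sP : smooth_at P (c g, mu).
  apply: smooth_at_pair; first exact: smooth_at_fst.
  apply: smooth_at_mulmx; last exact: smooth_at_snd.
  apply: (@lcoframe_smooth _ _ _ _ _ (fun z => cinv c z.1)) => //=.
    apply: (msmooth_comp (f := cinv c)); first exact: smooth_at_fst.
    by apply: msmooth_cinv => //; exact: cdom_cimg.
  by rewrite cmapK.
pose Hc (z : 'rV[R]_n * 'cV[R]_n) : R^o := H (of_canonical c z.1 z.2).
have sHc : smooth_at Hc (P (c g, mu)).
  exists (cimg c `*` setT); split; last exact: sH.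
    have -> : cimg c `*` [set: 'cV[R]_n] = fst @^-1` cimg c.
      by apply/seteqP; split=> z /=; [case|].
    by apply: open_comp; [move=> z _; exact: cvg_fst|exact: cimg_open].
  by split => //=; exact: cdom_cimg.
apply: eq_smooth_at (smooth_at_comp sP sHc); near=> z.
have cz : cimg c z.1.
  near: z; apply: (smooth_at_continuous (smooth_at_fst (c g, mu))).
  exact/cimg_near/cdom_cimg.
rewrite (left_triv_hamiltonianE _ _ ac) ?cmap_cinv//; exact: cinv_cdom.
Unshelve. all: by end_near. Qed.

(** The differential of [h] along the left-invariant frame does not depend on
    the chart. *)
Lemma ltrans_dual_partial_g h c g mu : triv_smooth_fun h -> atlas c ->
  cdom c g -> ltrans_dual (partial_g h g mu) =
    lframe c g *m grad (fun q => h (cinv c q, mu)) (c g).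
Proof.
move=> sh ac cg; rewrite ltrans_dualE.
have frame c' xi : atlas c' -> cdom c' g ->
    (xi *m (lframe c' g *m grad (fun q => h (cinv c' q, mu)) (c' g))) 0 0 =
    'D_xi (fun v => h (g * cinv chart1 v, mu)%g) unit1.
  move=> ac' cg'.
  have sm : smooth_at (fun q => h (cinv c' q, mu)) (c' g).
    have sp : smooth_at (fun q : 'rV[R]_n => (q, mu)) (c' g).
      by apply: smooth_at_pair; [exact: smooth_at_id|exact: smooth_at_cst].
    exact: (smooth_at_comp sp (sh c' g mu ac' cg')).
  rewrite mulmxA -gradE; last exact: smooth_at_differentiable.
  exact: (derive_lframe (F := fun x => h (x, mu)) xi ac' cg'
    (smooth_at_differentiable sm)).
apply: mulmx_cV_inj => xi; rewrite (frame _ xi ac cg).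
by apply: (frame (chart_at g)); [exact: chart_at_atlas|exact: chart_at_dom].
Qed.

Section Along.
Context {V : normedModType R} {fV : findim V}.
Variables (h : G * dual_lie_algebra G -> R) (sh : triv_smooth_fun h).
Variables (f : V -> G) (m : V -> 'cV[R]_n) (u : V).
Hypotheses (sf : msmooth_at f u) (sm : smooth_at m u).
Let c := chart_at (f u).
Let ac : atlas c. Proof. exact: chart_at_atlas. Qed.
Let cf : cdom c (f u). Proof. exact: chart_at_dom. Qed.
Let cfn : \forall y \near u, cdom c (f y).
Proof. exact: msmooth_cdom_near. Qed.
Let Fh (z : 'rV[R]_n * 'cV[R]_n) : R := h (cinv c z.1, z.2).
Let z0 (y : V) := (c (f y), m y).
Let sz0 : smooth_at z0 u.
Proof. by apply: smooth_at_pair => //; exact: (msmooth_chart sf). Qed.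
Let sFh : smooth_at Fh (z0 u). Proof. exact: sh. Qed.
Let FhE : \forall y \near u, (Fh \o z0) y = h (f y, m y).
Proof. by near=> y; rewrite /Fh /= cmapK//; near: y. Unshelve. all: by end_near. Qed.

Lemma triv_fun_smooth : smooth_at (fun y => h (f y, m y)) u.
Proof. by apply: eq_smooth_at FhE _; exact: smooth_at_comp. Qed.

(** The two partial derivatives are separated by linearity; the one in the
    group variable is taken along [logd f w u *m lframe c (f u)], hence is the
    pairing with [ltrans_dual (partial_g _ _ _)]. *)
Lemma triv_fun_derive w : 'D_w (fun y => h (f y, m y)) u =
  pairing ('D_w m u) (partial_mu h (f u) (m u)) +
  pairing (ltrans_dual (partial_g h (f u) (m u))) (logd f w u).
Proof.
have dF := smooth_at_differentiable sFh.
have dz := smooth_at_differentiable sz0.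
have E1 : 'D_w (fun y => h (f y, m y)) u = 'D_('D_w z0 u) Fh (z0 u).
  by rewrite -derive_comp//; apply/esym/near_eq_derive.
have dq : differentiable (c \o f) u.
  by apply: smooth_at_differentiable; exact: msmooth_chart.
have dm := smooth_at_differentiable sm.
have E2 : 'D_w z0 u = ('D_w (c \o f) u, 'D_w m u).
  exact: (@derive_pair _ _ _ _ (c \o f) m u w dq dm).
have E3 : 'D_('D_w z0 u) Fh (z0 u) =
    'D_(0, 'D_w m u) Fh (z0 u) + 'D_('D_w (c \o f) u, 0) Fh (z0 u).
  rewrite !(deriveE _ dF) -linearD E2; congr ('d Fh _ _).
  by rewrite -[RHS]/(0 + _, _ + 0) add0r addr0.
have sp1 : smooth_at (fun q : 'rV[R]_n => (q, m u)) (c (f u)).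
  by apply: smooth_at_pair; [exact: smooth_at_id|exact: smooth_at_cst].
have sp2 : smooth_at (fun p : 'cV[R]_n => (c (f u), p)) (m u).
  by apply: smooth_at_pair; [exact: smooth_at_cst|exact: smooth_at_id].
have d1 : differentiable (fun q => Fh (q, m u)) (c (f u)).
  exact/smooth_at_differentiable/(smooth_at_comp sp1 sFh).
have d2 : differentiable (fun p => Fh (c (f u), p)) (m u).
  exact/smooth_at_differentiable/(smooth_at_comp sp2 sFh).
rewrite E1 E3; congr (_ + _).
  apply: etrans (esym (derive_partial2 _ _ _ _)) _.
  apply: etrans (cogradE _ d2) _.
  by rewrite /pairing /partial_mu /Fh /= cmapK.
apply: etrans (esym (derive_partial1 _ _ _ _)) _.
apply: etrans (gradE _ d1) _.
rewrite /pairing (ltrans_dual_partial_g _ sh ac cf) mulmxA.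
by rewrite (logd_lframe w sf ac cf).
Qed.

Lemma partial_mu_smooth : smooth_at (fun y => partial_mu h (f y) (m y)) u.
Proof.
apply/smooth_at_mx => i j.
have sD : smooth_at ('D_(0, delta_mx j 0) Fh \o z0) u.
  by apply: smooth_at_comp => //; exact: smooth_at_derive.
apply: eq_smooth_at sD; near=> y.
rewrite /= -(derive_partial2 Fh) /partial_mu mxE /Fh /= cmapK//.
by near: y.
Unshelve. all: by end_near. Qed.

Lemma partial_g_smooth :
  smooth_at (fun y => ltrans_dual (partial_g h (f y) (m y)) : 'cV[R]_n) u.
Proof.
have sg : smooth_at (fun y => \col_i ('D_(delta_mx 0 i, 0) Fh \o z0) y) u.
  apply/smooth_at_mx => i j.
  have sD : smooth_at ('D_(delta_mx 0 i, 0) Fh \o z0) u.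
    by apply: smooth_at_comp => //; exact: smooth_at_derive.
  by apply: eq_smooth_at sD; apply: nearW => y; rewrite mxE.
have sL : smooth_at (fun y : V => lframe c (f y)) u by exact: lframe_smooth.
apply: eq_smooth_at (smooth_at_mulmx sL sg); near=> y.
have cy : cdom c (f y) by near: y.
rewrite (ltrans_dual_partial_g _ sh ac cy); congr (_ *m _).
by apply/colP => i; rewrite !mxE /= -(derive_partial1 Fh).
Unshelve. all: by end_near. Qed.

End Along.
End TrivializedFunctions.

(** * Integrals over [0, T] *)

Section IntegralCalculus.
Context {R : realType}.
Variables (T : R) (T0 : 0 < T).
Implicit Types (f : R -> R).
Local Notation mu := (@lebesgue_measure R).

Lemma within_continuous f :
  (forall t, t \in `[0, T] -> {for t, continuous f}) ->
  {within `[0, T], continuous f}.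
Proof.
move=> cf; apply: continuous_in_subspaceT => t; rewrite inE /= => tT.
exact: cf.
Qed.

Lemma continuous_integrable f :
  (forall t, t \in `[0, T] -> {for t, continuous f}) ->
  mu.-integrable `[0, T] (EFin \o f).
Proof.
move=> cf; apply: continuous_compact_integrable; first exact: segment_compact.
exact: within_continuous.
Qed.

Lemma Rintegral_derive f (F : R -> R) :
  (forall t, t \in `[0, T] -> smooth_at F t) ->
  (forall t, t \in `[0, T] -> 'D_1 F t = f t) ->
  \int[mu]_(t in `[0, T]) f t = F T - F 0.
Proof.
move=> sF Ff.
have oc t : t \in `]0, T[ -> t \in `[0, T] by exact: subset_itv_oo_cc.
have e0 : 0 \in `[0, T] by rewrite in_itv /= lexx ltW.
have eT : T \in `[0, T] by rewrite in_itv /= lexx ltW.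
pose f' := 'D_1 F : R -> R.
have -> : \int[mu]_(t in `[0, T]) f t = \int[mu]_(t in `[0, T]) f' t.
  by apply: eq_Rintegral => t; rewrite inE => tT; exact/esym/Ff.
rewrite /Rintegral (@continuous_FTC2 _ f' F 0 T)//.
- apply: within_continuous => t /sF st.
  exact/smooth_at_continuous/smooth_at_derive.
- split.
  + by move=> t /oc/sF st; exact: smooth_at_derivable.
  + by apply: cvg_at_right_filter; exact/smooth_at_continuous/sF.
  + by apply: cvg_at_left_filter; exact/smooth_at_continuous/sF.
- by move=> t _; rewrite derive1E.
Qed.

(** The primitive of [f] from [0] is squeezed between [0] and the whole
    integral, so it vanishes, and so does its derivative. *)
Lemma Rintegral_eq0 f :
  (forall t, t \in `[0, T] -> {for t, continuous f}) ->
  (forall t, t \in `[0, T] -> 0 <= f t) ->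
  \int[mu]_(t in `[0, T]) f t = 0 ->
  forall t, t \in `]0, T[ -> f t = 0.
Proof.
move=> cf f0 fT t tT; pose F x := \int[mu]_(s in `[0, x]) f s.
have fi := continuous_integrable cf.
have F0 x : x \in `]0, T[ -> F x = 0.
  rewrite in_itv /= => /andP[x0 xT]; apply/eqP; rewrite eq_le.
  have sub s : s \in `[0, x] -> s \in `[0, T].
    by rewrite !in_itv /= => /andP[-> sx] /=; exact: le_trans sx (ltW xT).
  apply/andP; split; last first.
    by apply: Rintegral_ge0 => s /= /sub; exact: f0.
  have := @Rintegral_itvB R f (BLeft 0) (BRight T) x.
  rewrite !bnd_simp fT => /(_ fi (ltW x0) (ltW xT)).
  rewrite sub0r => E; rewrite -oppr_ge0 E; apply: Rintegral_ge0 => s /=.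
  rewrite in_itv /= => /andP[xs sT]; apply: f0; rewrite in_itv /= sT andbT.
  exact: le_trans (ltW x0) (ltW xs).
move: (tT); rewrite in_itv /= => /andP[t0 tlt].
have tT' : t \in `[0, T] by exact: subset_itv_oo_cc.
have FE : \forall x \near t, F x = cst 0 x.
  by near=> x; rewrite F0//; near: x; exact: near_in_itvoo.
have D0 : 'D_1 F t = 0 by rewrite (near_eq_derive _ FE) derive_cst.
have [_ FtE] := continuous_FTC1_closed tlt fi t0 (cf _ tT').
by apply: etrans (esym FtE) _; rewrite derive1E.
Unshelve. all: by end_near. Qed.

(** Differentiation under the integral sign: on a compact rectangle around
    [{0} * [0, T]] the derivative in the parameter is bounded. *)
Lemma Rintegral_leibniz (L : R * R -> R) :
  (\forall e \near (0 : R), forall t, t \in `[0, T] -> smooth_at L (e, t)) ->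
  is_derive (0 : R) (1 : R) (fun e => \int[mu]_(t in `[0, T]) L (e, t) : R)
    (\int[mu]_(t in `[0, T]) ('D_(1, 0) L : R * R -> R) (0, t)).
Proof.
move=> /nbhs_normP[d d0 sL].
have {}sL e t : `|e| < d -> t \in `[0, T] -> smooth_at L (e, t).
  by move=> ed; apply: sL; rewrite /= sub0r normrN.
pose r := d / 2; have r0 : 0 < r by rewrite divr_gt0.
have rd : r < d by rewrite /r ltr_pdivrMr// ltr_pMr// ltr1n.
pose DL : R * R -> R := 'D_(1, 0) L.
pose K : set (R * R) := `[- r, r] `*` `[0, T].
have sK z : K z -> smooth_at L z.
  case: z => e t [/= eI tI]; apply: sL => //.
  by rewrite (le_lt_trans _ rd)// ler_norml; move: eI; rewrite in_itv.
have e0 : 0 \in `[0, T] by rewrite in_itv /= lexx ltW.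
have [zM _ zMP] : exists2 z, z \in K & forall y, y \in K -> `|DL y| <= `|DL z|.
  apply: (@compact_EVT_max _ _ (fun z => `|DL z|)).
  - by exists (0, 0); split => //=; rewrite in_itv /= oppr_le0 ltW.
  - by apply: compact_setX; exact: segment_compact.
  - apply: continuous_in_subspaceT => z; rewrite inE => Kz.
    apply: continuous_comp; last exact: norm_continuous.
    exact/smooth_at_continuous/smooth_at_derive/sK.
pose C := `|DL zM|.
have mT : measurable (`[0, T]%classic : set R) by exact: measurable_itv.
have I0 : `]-r, r[%classic (0 : R) by rewrite /= in_itv /= oppr_lt0 r0.
have Ir x : `]-r, r[%classic x -> `|x| < d.
  rewrite /= in_itv /= => xr; apply: lt_trans rd.
  by rewrite ltr_norml.
have intL x : `]-r, r[%classic x ->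
    mu.-integrable `[0, T] (EFin \o (fun t => L (x, t))).
  move=> /Ir xd; apply: continuous_integrable => t tT.
  apply: (@continuous_comp _ _ _ (fun t : R => (x, t)) L).
    apply: (@smooth_at_continuous _ R (R * R)%type); apply: smooth_at_pair.
      exact: smooth_at_cst.
    exact: smooth_at_id.
  by apply: smooth_at_continuous; exact: sL.
have part x y : partial1of2 (fun x t => L (x, t)) x y = DL (x, y).
  by rewrite partial1of2E; exact: (derive_partial1 L).
have derL x y : `]-r, r[%classic x -> `[0, T]%classic y ->
    derivable (fun x => L (x, y)) x 1.
  move=> /Ir xd yT; have := smooth_at_differentiable (sL x y xd yT) => dL.
  apply: diff_derivable.
  apply: (@differentiable_comp _ _ _ _ (fun x : R => (x, y)) L) => //.
have C0 (y : R) : 0 <= C by exact: normr_ge0.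
have intC : mu.-integrable `[0, T] (EFin \o (fun=> C)).
  by apply: continuous_integrable => t _; exact: cvg_cst.
have bC x y : `]-r, r[%classic x -> `[0, T]%classic y ->
    `|partial1of2 (fun x t => L (x, t)) x y| <= C.
  move=> xr yT; rewrite part; apply: zMP; rewrite inE; split => //=.
  by move: xr; rewrite /= !in_itv /= => /andP[/ltW -> /ltW ->].
have D := @derivable_under_integral R _ _ mu (fun x t => L (x, t)) _ mT
  0 (- r) r I0 intL derL (fun=> C) C0 intC bC.
have DE := @differentiation_under_integral R _ _ mu (fun x t => L (x, t)) _ mT
  0 (- r) r I0 intL derL (fun=> C) C0 intC bC.
apply: DeriveDef; first exact: D.
rewrite -derive1E; apply: etrans DE _.
by apply: eq_Rintegral => t _; rewrite part.
Qed.

End IntegralCalculus.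

(** * The first variation of the action *)

Section Pairing.
Context {R : realType} {n : nat}.
Implicit Types V W : normedModType R.

Lemma smooth_at_pairing V (p : V -> 'cV[R]_n) (w : V -> 'rV[R]_n) u :
  smooth_at p u -> smooth_at w u -> smooth_at (fun y => pairing (p y) (w y)) u.
Proof.
move=> sp sw; exact: ((smooth_at_mx _ _).1 (smooth_at_mulmx sw sp) 0 0).
Qed.

Lemma derive_pairing V (p : V -> 'cV[R]_n) (w : V -> 'rV[R]_n) u v :
  smooth_at p u -> smooth_at w u ->
  'D_v (fun y => pairing (p y) (w y)) u =
    pairing ('D_v p u) (w u) + pairing (p u) ('D_v w u).
Proof.
move=> sp sw; have E := derive_entry v 0 0 (smooth_at_mulmx sw sp).
by apply: etrans E _; rewrite (derive_mulmx v sw sp) mxE addrC.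
Qed.

Lemma pairingDr (p : 'cV[R]_n) v w : pairing p (v + w) = pairing p v + pairing p w.
Proof. by rewrite /pairing mulmxDl mxE. Qed.

Lemma pairing_split (p q a c : 'cV[R]_n) x y e :
  pairing p (x - y) + pairing (- q + a - c) e =
  (pairing p x - pairing p y) + (- pairing q e + pairing a e - pairing c e).
Proof.
by rewrite /pairing !(mulmxDr, mulmxN) mulmxDl mulNmx !mxE.
Qed.

(** A derivative at a point of [0, T] is determined by the values on [0, T],
    as a limit from one side. *)
Lemma eq_derive_itv W (T : R) (f f' : R -> W) t : 0 < T ->
  (forall s, s \in `[0, T] -> f s = f' s) -> t \in `[0, T] ->
  derivable f t 1 -> derivable f' t 1 -> 'D_1 f t = 'D_1 f' t.
Proof.
move=> T0 ff tT df df'.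
have fft := ff t tT.
pose q (k : R -> W) (h : R) := h^-1 *: ((k \o shift t) (h *: 1) - k t).
have qE h : h + t \in `[0, T] -> q f h = q f' h.
  by move=> hT; rewrite /q /= fft [h *: 1]mulr1 ff.
move: (tT); rewrite in_itv /= => /andP[t0 tT'].
rewrite -[LHS]/(lim (q f @ 0^')) -[RHS]/(lim (q f' @ 0^')).
have [tlt|tge] := ltP t T.
  rewrite (@cvg_at_rightE _ _ (q f) 0 df) (@cvg_at_rightE _ _ (q f') 0 df'); congr (lim _).
  have E : \forall h \near (0 : R)^'+, q f h = q f' h.
    near=> h; apply: qE; rewrite in_itv /=; apply/andP; split.
      by rewrite addr_ge0// ltW.
    rewrite -lerBrDr; near: h; apply: nbhs_right_le; by rewrite subr_gt0.
  by rewrite eqEsubset; split; apply: near_eq_cvg => //;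
    apply: filterS E => h ->.
rewrite (@cvg_at_leftE _ _ (q f) 0 df) (@cvg_at_leftE _ _ (q f') 0 df'); congr (lim _).
have E : \forall h \near (0 : R)^'-, q f h = q f' h.
  near=> h; apply: qE; rewrite in_itv /=; apply/andP; split.
    rewrite -lerBlDr sub0r; near: h; apply: nbhs_left_ge.
    by rewrite oppr_lt0; exact: lt_le_trans T0 tge.
  by apply: le_trans tT'; rewrite gerDr ltW.
by rewrite eqEsubset; split; apply: near_eq_cvg => //;
  apply: filterS E => h ->.
Unshelve. all: by end_near. Qed.

End Pairing.

Section FirstVariation.
Context {R : realType} {n : nat} {G : lieGroupType R n}.
Local Notation unit1 := (@unit1 R n G).
Local Notation chart1 := (@chart1 R n G).

Lemma ad_linear (zeta : lie_algebra G) : linear (ad zeta : 'rV[R]_n -> 'rV[R]_n).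
Proof.
have dA := smooth_at_differentiable (@lframe_smooth_unit R n G).
move=> a x y; rewrite !adE !(deriveE _ dA) linearP mulmxDl mulmxDr -scalemxAl -scalemxAr.
by rewrite scalerBr opprD addrACA.
Qed.

Lemma pairing_ad (xi eta : lie_algebra G) (mu : dual_lie_algebra G) :
  pairing mu (ad xi eta) = pairing (ad_dual xi mu) eta.
Proof.
pose l : {linear 'rV[R]_n -> 'rV[R]_n} :=
  HB.pack (ad xi : 'rV[R]_n -> 'rV[R]_n)
    (GRing.isLinear.Build _ _ _ _ _ (ad_linear xi)).
by rewrite /pairing /ad_dual /dual_map mulmxA (mul_rV_lin1 l).
Qed.

Variables (T : R) (T0 : 0 < T).
Variables (h : G * dual_lie_algebra G -> R) (sh : triv_smooth_fun h).
Implicit Types (z : R -> G * dual_lie_algebra G).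
Implicit Types (F : R -> R -> G * dual_lie_algebra G).

Definition smooth_curve z := forall t, t \in `[0, T] -> triv_smooth_at z t.

(** The defects of the two Lie-Poisson equations, with the velocity replaced
    by its left logarithmic derivative; they are the coefficients of [delta_mu]
    and of [eta] in the first variation. *)
Definition residual_g z t : 'rV[R]_n :=
  logd (fst \o z) 1 t - partial_mu h (z t).1 (z t).2.

Definition residual_mu z t : 'cV[R]_n :=
  - 'D_1 (snd \o z : R -> 'cV[R]_n) t
  + ad_dual (logd (fst \o z) 1 t : lie_algebra G) (z t).2
  - ltrans_dual (partial_g h (z t).1 (z t).2).

Lemma lie_poisson_residual z t : lie_poisson_equations h z t <->
  residual_g z t = 0 /\ residual_mu z t = 0.
Proof.
rewrite /lie_poisson_equations /residual_g /residual_mu /= derive1E.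
split=> [[/velocity_ltransP-> ->]|[/eqP]].
  rewrite subrr; split=> //.
  by rewrite opprD opprK addrNK addrN.
rewrite subr_eq0 => /eqP gE muE; split; first exact/velocity_ltransP.
have -> : 'D_1 (fun s => (z s).2 : 'cV[R]_n) t = 'D_1 (snd \o z : R -> 'cV[R]_n) t by [].
move/eqP: muE; rewrite gE -addrA addrC subr_eq0 => /eqP <-.
by rewrite addrC.
Qed.

Lemma residual_g_smooth z t : triv_smooth_at z t -> smooth_at (residual_g z) t.
Proof.
move=> [sg sm].
have s1 : smooth_at (logd (fst \o z) 1) t by exact: logd_smooth.
have s2 : smooth_at (fun s => partial_mu h (z s).1 (z s).2 : 'rV[R]_n) t.
  exact: (partial_mu_smooth sh sg sm).
have sN : smooth_at (fun s => (-1 : R) *: partial_mu h (z s).1 (z s).2) t.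
  by apply: smooth_atZ => //; exact: smooth_at_cst.
apply: ext_smooth_at (smooth_atD s1 sN) _ => s.
by rewrite /residual_g scaleN1r.
Qed.

Lemma ad_dualE (xi : lie_algebra G) (mu : dual_lie_algebra G) :
  ad_dual xi mu = \col_i (pairing mu (ad xi (delta_mx 0 i : lie_algebra G))).
Proof.
apply/colP => i; rewrite [RHS]mxE pairing_ad /pairing.
by rewrite -rowE [RHS]mxE.
Qed.

Lemma ad_dual_smooth (V : normedModType R) {fV : findim V} (xi : V -> 'rV[R]_n)
    (mu : V -> 'cV[R]_n) u : smooth_at xi u -> smooth_at mu u ->
  smooth_at (fun y => ad_dual (xi y : lie_algebra G) (mu y) : 'cV[R]_n) u.
Proof.
move=> sxi smu; apply/smooth_at_mx => i j.
pose A q := lframe chart1 (cinv chart1 q : G).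
have dA := smooth_at_differentiable (@lframe_smooth_unit R n G).
pose l : {linear 'rV[R]_n -> 'M[R]_n} := 'd A unit1.
have cl : continuous l by exact: diff_continuous.
have sl : smooth_at (fun y => l (xi y)) u.
  by apply: smooth_at_comp => //; exact: smooth_at_linear.
have sad : smooth_at (fun y => (delta_mx 0 i : 'rV_n) *m l (xi y)
    + (-1 : R) *: (xi y *m 'D_(delta_mx 0 i) A unit1)) u.
  apply: smooth_atD.
    by apply: smooth_at_mulmx => //; exact: smooth_at_cst.
  apply: smooth_atZ; first exact: smooth_at_cst.
  by apply: smooth_at_mulmx => //; exact: smooth_at_cst.
apply: ext_smooth_at (smooth_at_pairing smu sad) _ => y.
by rewrite ad_dualE mxE adE scaleN1r (deriveE (xi y) dA).
Qed.

Lemma residual_mu_smooth z t : triv_smooth_at z t -> smooth_at (residual_mu z) t.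
Proof.
move=> [sg sm].
have s1 : smooth_at (logd (fst \o z) 1) t by exact: logd_smooth.
have sN (f : R -> 'cV[R]_n) : smooth_at f t -> smooth_at (fun s => (-1 : R) *: f s) t.
  by move=> sf; apply: smooth_atZ => //; exact: smooth_at_cst.
have s2 : smooth_at (fun s => (-1 : R) *:
    (ltrans_dual (partial_g h (z s).1 (z s).2) : 'cV[R]_n)) t.
  by apply: sN; exact: (partial_g_smooth sh sg sm).
have s3 : smooth_at (fun s => (-1 : R) *: 'D_1 (snd \o z : R -> 'cV[R]_n) s) t.
  by apply: sN; exact: smooth_at_derive.
have s4 : smooth_at (fun s => ad_dual (logd (fst \o z) 1 s : lie_algebra G)
    (z s).2 : 'cV[R]_n) t by exact: (ad_dual_smooth s1 sm).
apply: ext_smooth_at (smooth_atD (smooth_atD s3 s4) s2) _ => s.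
by rewrite /residual_mu !scaleN1r.
Qed.

Lemma eq_logd_itv (f f' : R -> G) t : (forall s, s \in `[0, T] -> f s = f' s) ->
  t \in `[0, T] -> msmooth_at f t -> msmooth_at f' t -> logd f 1 t = logd f' 1 t.
Proof.
move=> ff tT sf sf'; set c := chart_at (f t).
have ac : atlas c by exact: chart_at_atlas.
have cf : cdom c (f t) by exact: chart_at_dom.
have cf' : cdom c (f' t) by rewrite -ff.
have E1 : logd f 1 t = 'D_1 (c \o f) t *m lcoframe c (f t) by exact: logd_chart.
have E2 : logd f' 1 t = 'D_1 (c \o f') t *m lcoframe c (f' t).
  exact: logd_chart.
have D : 'D_1 (c \o f) t = 'D_1 (c \o f') t.
  apply: (eq_derive_itv T0 _ tT) => [s sT /=||]; first by rewrite ff.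
    by apply: smooth_at_derivable; exact: (msmooth_chart sf).
  by apply: smooth_at_derivable; exact: (msmooth_chart sf').
have LE := congr1 (lcoframe c) (ff t tT).
exact: (etrans E1 (etrans (congr2 mulmx D LE) (esym E2))).
Qed.

(** First variation of the action.  The Maurer-Cartan equation turns the
    variation of the velocity [g^-1 . g'] into [eta' + [xi, eta]]; the rest is
    an integration by parts, whose boundary term at [0] vanishes with [eta]. *)
Lemma first_variation z F : smooth_curve z -> triv_family T z F ->
  let eta t : 'rV[R]_n := ltrans_inv (velocity (fun eps => (F eps t).1) 0) in
  let delta_mu t : 'cV[R]_n := derive1 (fun eps => (F eps t).2 : 'cV[R]_n) 0 in
  eta 0 = 0 ->
  is_derive (0 : R) (1 : R) (fun eps => triv_action_integral T h (F eps) : R^o)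
    (pairing (z T).2 (eta T) + \int[lebesgue_measure]_(t in `[0, T])
      (pairing (delta_mu t) (residual_g z t) + pairing (residual_mu z t) (eta t))).
Proof.
move=> sz [F0 sF] eta delta_mu eta0.
pose Fu (u : R * R) := F u.1 u.2.
pose g (u : R * R) : G := (Fu u).1; pose m (u : R * R) : 'cV[R]_n := (Fu u).2.
pose xi := logd g (0, 1); pose et := logd g (1, 0).
have sF0 := nbhs_singleton sF.
have sgm e t : triv_smooth_at Fu (e, t) -> msmooth_at g (e, t) /\ smooth_at m (e, t).
  by case.
have etaE t : eta t = et (0, t).
  by rewrite /eta ltrans_inv_velocity; exact: (logd_partial1 g).
have dmuE t : delta_mu t = 'D_(1, 0) m (0, t).
  by rewrite /delta_mu derive1E; exact: (derive_partial1 m).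
pose L u := pairing (m u) (xi u) - h (g u, m u).
have actE e : triv_action_integral T h (F e) =
    \int[lebesgue_measure]_(t in `[0, T]) L (e, t).
  apply: eq_Rintegral => t _; rewrite /L ltrans_inv_velocity.
  rewrite -[g (e, t)]/(F e t).1 -[m (e, t)]/(F e t).2 -surjective_pairing.
  by congr (pairing _ _ - _); exact: (logd_partial2 g).
rewrite (_ : (fun eps => _) = (fun e => \int[lebesgue_measure]_(t in `[0, T]) L (e, t))); last first.
  by apply/funext => e; exact: actE.
have sxi e t : triv_smooth_at Fu (e, t) -> smooth_at xi (e, t).
  by move=> /sgm[sg _]; exact: logd_smooth.
have set_ e t : triv_smooth_at Fu (e, t) -> smooth_at et (e, t).
  by move=> /sgm[sg _]; exact: logd_smooth.
have sh' e t : triv_smooth_at Fu (e, t) -> smooth_at (fun u => h (g u, m u)) (e, t).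
  by move=> /sgm[sg sm]; exact: (triv_fun_smooth sh).
have sp e t : triv_smooth_at Fu (e, t) -> smooth_at (fun u => pairing (m u) (xi u)) (e, t).
  by move=> s; apply: smooth_at_pairing; [exact: (sgm _ _ s).2|exact: sxi].
have sL e t : triv_smooth_at Fu (e, t) -> smooth_at L (e, t).
  move=> s; have s1 : smooth_at (fun u => (-1 : R) * h (g u, m u)) (e, t).
    by apply: smooth_atM; [exact: smooth_at_cst|exact: sh'].
  apply: ext_smooth_at (smooth_atD (sp _ _ s) s1) _ => u.
  by rewrite mulN1r.
have sL' : \forall e \near (0 : R), forall t, t \in `[0, T] -> smooth_at L (e, t).
  by apply: filterS sF => e se t tT; exact/sL/se.
have spair t : smooth_at (fun y : R => ((0, y) : R * R)) t.
  by apply: smooth_at_pair; [exact: smooth_at_cst|exact: smooth_at_id].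
pose Phi t := pairing (m (0, t)) (et (0, t)).
have sPu t : t \in `[0, T] -> smooth_at (fun u => pairing (m u) (et u)) (0, t).
  by move=> /sF0 s; apply: smooth_at_pairing; [exact: (sgm _ _ s).2|exact: set_].
have sPhi t : t \in `[0, T] -> smooth_at Phi t.
  by move=> tT; exact: (smooth_at_comp (spair t) (sPu t tT)).
pose rest t := pairing (delta_mu t) (residual_g z t) + pairing (residual_mu z t) (eta t).
have Fz t : t \in `[0, T] -> Fu (0, t) = z t by exact: F0.
have xiE t : t \in `[0, T] -> xi (0, t) = logd (fst \o z) 1 t.
  move=> tT; have E : logd (fun y : R => g (0, y)) 1 t = xi (0, t) := logd_partial2 g 0 1 t.
  rewrite -E; apply: eq_logd_itv => //; last by case: (sz t tT).
    by move=> s sT; rewrite /g Fz.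
  apply: (msmooth_comp (f := g)); [exact: spair|exact: (sgm _ _ (sF0 t tT)).1].
have DmE t : t \in `[0, T] -> 'D_(0, 1) m (0, t) = 'D_1 (snd \o z : R -> 'cV[R]_n) t.
  move=> tT; have E : 'D_1 (fun y : R => m (0, y)) t = 'D_(0, 1) m (0, t) := derive_partial2 m 0 t 1.
  rewrite -E; apply: (eq_derive_itv T0 _ tT) => [s sT||].
  - by rewrite /m Fz.
  - apply: smooth_at_derivable.
    exact: (smooth_at_comp (spair t) (sgm _ _ (sF0 t tT)).2).
  - by apply: smooth_at_derivable; case: (sz t tT).
have alg (a1 mD b1 c dm de adt : R) : mD = de + adt ->
    a1 + mD - (b1 + c) = (dm + de) + ((a1 - b1) + (- dm + adt - c)).
  by move=> ->; ring.
have DLE t : t \in `[0, T] -> ('D_(1, 0) L : R * R -> R) (0, t) = 'D_1 Phi t + rest t.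
  move=> tT; have s := sF0 t tT; have [sg sm] := sgm _ _ s.
  have DL : 'D_(1, 0) L (0, t) = 'D_(1, 0) (fun u => pairing (m u) (xi u)) (0, t)
      - 'D_(1, 0) (fun u => h (g u, m u)) (0, t).
    apply: (@deriveB _ _ _ (fun u => pairing (m u) (xi u)) (fun u => h (g u, m u))).
      exact/smooth_at_derivable/sp.
    exact/smooth_at_derivable/sh'.
  have D1 : 'D_(1, 0) (fun u => pairing (m u) (xi u)) (0, t) = _ :=
    @derive_pairing R n _ m xi (0, t) (1, 0) sm (sxi _ _ s).
  have D2 : 'D_(1, 0) (fun u => h (g u, m u)) (0, t) =
      pairing ('D_(1, 0) m (0, t)) (partial_mu h (g (0, t)) (m (0, t))) +
      pairing (ltrans_dual (partial_g h (g (0, t)) (m (0, t)))) (et (0, t)).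
    exact: (triv_fun_derive sh sg sm).
  have D3 : 'D_1 Phi t = 'D_(0, 1) (fun u => pairing (m u) (et u)) (0, t) :=
    derive_partial2 (fun u => pairing (m u) (et u)) 0 t 1.
  have D4 := @derive_pairing R n _ m et (0, t) (0, 1) sm (set_ _ _ s).
  have MC : 'D_(1, 0) xi (0, t) - 'D_(0, 1) et (0, t) =
    ad (xi (0, t) : lie_algebra G) (et (0, t)) by exact: maurer_cartan.
  have mD : pairing (m (0, t)) ('D_(1, 0) xi (0, t)) =
      pairing (m (0, t)) ('D_(0, 1) et (0, t)) +
      pairing (ad_dual (xi (0, t) : lie_algebra G) (m (0, t))) (et (0, t)).
    by rewrite -pairing_ad -pairingDr -MC addrC subrK.
  apply: etrans DL _; rewrite D1 D2 D3 D4.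
  apply: etrans (alg _ _ _ _ (pairing ('D_(0, 1) m (0, t)) (et (0, t))) _ _ mD) _.
  rewrite /rest etaE dmuE /residual_g /residual_mu -(xiE _ tT) -(DmE _ tT) -(Fz t tT).
  by congr (_ + _); exact: esym (pairing_split _ _ _ _ _ _ _).
have crest t : t \in `[0, T] -> {for t, continuous rest}.
  move=> tT; have s := sF0 t tT; have [sg sm] := sgm _ _ s.
  apply: smooth_at_continuous; apply: smooth_atD; apply: smooth_at_pairing.
  - have sD : smooth_at ('D_(1, 0) m) (0, t) by exact: smooth_at_derive.
    by apply: ext_smooth_at (smooth_at_comp (spair t) sD) _ => y; rewrite dmuE.
  - exact/residual_g_smooth/sz.
  - exact/residual_mu_smooth/sz.
  - apply: ext_smooth_at (smooth_at_comp (spair t) (set_ _ _ s)) _ => y.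
    by rewrite etaE.
have cDPhi t : t \in `[0, T] -> {for t, continuous ('D_1 Phi : R -> R)}.
  by move=> /sPhi sPt; exact/smooth_at_continuous/smooth_at_derive.
have e0 : 0 \in `[0, T] by rewrite in_itv /= lexx ltW.
have eT : T \in `[0, T] by rewrite in_itv /= lexx ltW.
have mT : measurable (`[0, T]%classic : set R) by exact: measurable_itv.
apply: is_derive_eq (Rintegral_leibniz T0 sL') _.
have -> : \int[lebesgue_measure]_(t in `[0, T]) ('D_(1, 0) L : R * R -> R) (0, t)
  = \int[lebesgue_measure]_(t in `[0, T]) (('D_1 Phi : R -> R) t + rest t).
  by apply: eq_Rintegral => t; rewrite inE => tT; exact: DLE.
rewrite RintegralD//; try exact: continuous_integrable.
congr (_ + _); rewrite (Rintegral_derive T0 sPhi)//.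
by rewrite /Phi -!etaE eta0 {2}/pairing mul0mx mxE subr0 /m Fz.
Qed.

End FirstVariation.

(** * From the variational principle to the Lie-Poisson equations *)

Section FundamentalLemma.
Context {R : realType} {n : nat} {G : lieGroupType R n}.
Local Notation unit1 := (@unit1 R n G).
Local Notation chart1 := (@chart1 R n G).

Lemma pairing_tr_ge0 (w : 'rV[R]_n) : 0 <= pairing w^T w.
Proof.
rewrite /pairing mxE; apply: sumr_ge0 => i _.
by rewrite mxE -expr2 sqr_ge0.
Qed.

Lemma pairing_tr_eq0 (w : 'rV[R]_n) : pairing w^T w = 0 -> w = 0.
Proof.
move/eqP; rewrite /pairing mxE psumr_eq0 => [/allP w0|i _]; last first.
  by rewrite mxE -expr2 sqr_ge0.
apply/rowP => i; have /implyP/(_ isT) := w0 i (mem_index_enum i).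
by rewrite !mxE -expr2 sqrf_eq0 => /eqP.
Qed.

Variables (T : R) (T0 : 0 < T).

Lemma derive_line (W : normedModType R) (a w : W) :
  'D_1 (fun e : R => a + e *: w) 0 = w.
Proof.
have d : differentiable ( *:%R ^~ w : R -> W) 0 by [].
have -> : (fun e : R => a + e *: w) = cst a + ( *:%R ^~ w) by [].
rewrite deriveD; [|exact: derivable_cst|exact: diff_derivable].
by rewrite derive_cst add0r deriveE// diff_val scale1r.
Qed.

Lemma continuous_itv_eq0 (W : normedModType R) (f : R -> W) t :
  (forall s, s \in `]0, T[ -> f s = 0) -> t \in `[0, T] ->
  {for t, continuous f} -> f t = 0.
Proof.
move=> f0 tT ft; pose l (d : R) := t + d * (T / 2 - t).
move: tT; rewrite in_itv /= => /andP[t0 tT].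
have T20 : 0 < T / 2 by rewrite divr_gt0.
have T2T : T / 2 < T by rewrite ltr_pdivrMr// ltr_pMr// ltr1n.
have l0 : l 0 = t by rewrite /l mul0r addr0.
have cl : {for 0, continuous l}.
  apply: smooth_at_continuous; apply: smooth_atD; first exact: smooth_at_cst.
  by apply: smooth_atM; [exact: smooth_at_id|exact: smooth_at_cst].
have c1 : f (l d) @[d --> (0 : R)^'+] --> f t.
  apply: cvg_at_right_filter; rewrite -l0; apply: (continuous_comp cl).
  by rewrite l0.
have c2 : f (l d) @[d --> (0 : R)^'+] --> (0 : W).
  apply: cvg_near_cst; near=> d.
  have d0 : 0 < d by [].
  have d1 : d < 1 by near: d; exact: nbhs_right_lt.
  apply: f0; rewrite in_itv /=.
  have -> : l d = (1 - d) * t + d * (T / 2) by rewrite /l; ring.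
  have dT : 0 < d * (T / 2) by rewrite mulr_gt0.
  have dt : 0 <= (1 - d) * t by rewrite mulr_ge0// subr_ge0 ltW.
  rewrite ltr_wpDl//=.
  rewrite [ltRHS](_ : _ = (1 - d) * T + d * T); last by ring.
  by rewrite ler_ltD// ?ltr_pM2l// ler_wpM2l// subr_ge0 ltW.
by apply: (cvg_unique _ c1 c2); exact: norm_hausdorff.
Unshelve. all: by end_near. Qed.

Variables (h : G * dual_lie_algebra G -> R) (sh : triv_smooth_fun h).
Variables (z : R -> G * dual_lie_algebra G) (sz : smooth_curve T z).

Section TestFamily.
Variables (eta : R -> 'rV[R]_n) (nu : R -> 'cV[R]_n).
Hypothesis seta : forall t, t \in `[0, T] -> smooth_at eta t.
Hypothesis snu : forall t, t \in `[0, T] -> smooth_at nu t.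

(** Multiplying [g] on the right by a curve through the identity makes [eta]
    the left-trivialized variation; the curve is a segment in the chart at the
    identity. *)
Definition test_family (e t : R) : G * dual_lie_algebra G :=
  ((z t).1 * cinv chart1 (unit1 + e *: eta t), (z t).2 + e *: nu t)%g.

(** As [eta] is bounded on [0, T], one bound on the parameter keeps
    [unit1 + e *: eta t] in the image of the chart for all [t] at once. *)
Lemma test_family_triv : triv_family T z test_family.
Proof.
have [C C0 etaC] : exists2 C : R, 0 < C & forall t, t \in `[0, T] -> `|eta t| < C.
  have [c cT cM] : exists2 c, c \in `[0, T] &
      forall t, t \in `[0, T] -> `|eta t| <= `|eta c|.
    apply: (@EVT_max _ (fun t => `|eta t|)); first exact: ltW.
    apply: within_continuous => t tT.
    apply: continuous_comp; last exact: norm_continuous.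
    exact/smooth_at_continuous/seta.
  exists (`|eta c| + 1); first by rewrite ltr_wpDl.
  by move=> t /cM tc; rewrite (le_lt_trans tc)// ltrDl.
split=> [t tT|].
  rewrite /test_family !scale0r !addr0 cinv_unit1 mulg1.
  by rewrite -surjective_pairing.
have /nbhs_normP[r r0 rI] := cimg_near (@unit1_cimg R n G).
near=> e => t tT.
have uI : cimg chart1 (unit1 + e *: eta t).
  apply: rI; rewrite /= opprD addrA subrr sub0r normrN normrZ.
  have eC : `|e| * C < r.
    rewrite -ltr_pdivlMr//; near: e.
    have := @nbhs0_lt R R (r / C) (divr_gt0 r0 C0).
    by apply: filterS => e.
  by apply: le_lt_trans eC; rewrite ler_wpM2l// ltW// etaC.
have ssnd (W : normedModType R) (fW : findim W) (f : R -> W) : smooth_at f t ->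
    smooth_at (fun u : R * R => f u.2) (e, t).
  by move=> sf; exact: (smooth_at_comp (smooth_at_snd (e, t)) sf).
have sfst : smooth_at (fun u : R * R => u.1) (e, t) by exact: smooth_at_fst.
have [sg sm] := sz tT.
split; last first.
  apply: smooth_atD; first exact: (ssnd _ _ _ sm).
  by apply: smooth_atZ => //; exact: (ssnd _ _ _ (snu tT)).
apply: msmooth_mul.
  by apply: (msmooth_comp (f := fst \o z)); [exact: smooth_at_snd|exact: sg].
apply: (msmooth_comp (f := cinv chart1)); last exact: msmooth_cinv.
apply: smooth_atD; first exact: smooth_at_cst.
by apply: smooth_atZ => //; exact: (ssnd _ _ _ (seta tT)).
Unshelve. all: by end_near. Qed.

Lemma test_family_eta t : t \in `[0, T] ->
  ltrans_inv (velocity (fun e => (test_family e t).1) 0) = eta t.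
Proof.
move=> tT; rewrite ltrans_inv_velocity.
set f := fun e => (test_family e t).1; set g := (z t).1.
have sf : msmooth_at f 0.
  have F0 := nbhs_singleton test_family_triv.2 t tT.
  apply: (msmooth_comp (phi := fun e : R => ((e, t) : R * R)) _ F0.1).
  by apply: smooth_at_pair; [exact: smooth_at_id|exact: smooth_at_cst].
have f0 : f 0 = g by rewrite /f /= scale0r addr0 cinv_unit1 mulg1.
set c := chart_at g; have ac : atlas c by exact: chart_at_atlas.
have cg : cdom c g by exact: chart_at_dom.
have cf : cdom c (f 0) by rewrite f0.
have E : logd f 1 0 = 'D_1 (c \o f) 0 *m lcoframe c (f 0) by exact: logd_chart.
pose phi v := c (g * cinv chart1 v)%g; pose l e := unit1 + e *: eta t.
have sl : smooth_at l 0.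
  apply: smooth_atD; first exact: smooth_at_cst.
  by apply: smooth_atZ; [exact: smooth_at_id|exact: smooth_at_cst].
have l0 : l 0 = unit1 by rewrite /l scale0r addr0.
have dl : 'D_1 l 0 = eta t by exact: derive_line.
have sphi : smooth_at phi (l 0) by rewrite l0; exact: smooth_lmul.
have DE : 'D_1 (c \o f) 0 = 'D_('D_1 l 0) phi (l 0) :=
  @derive_comp R R _ _ l phi 0 1 (smooth_at_differentiable sl)
    (smooth_at_differentiable sphi).
rewrite dl l0 (lframe_derive (eta t) ac cg) in DE.
by rewrite E DE f0 -mulmxA lframeK// mulmx1.
Qed.

Lemma test_family_mu t :
  derive1 (fun e => (test_family e t).2 : 'cV[R]_n) 0 = nu t.
Proof.
by rewrite derive1E; exact: derive_line.
Qed.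

End TestFamily.

(** The direct implication is the first variation formula; for the converse,
    the residuals themselves, weighted to respect the boundary conditions, give
    the test variation [eta = t *: residual_mu^T],
    [delta_mu = (T - t) *: residual_g^T]. *)
Lemma triv_dAlembert_lie_poisson : triv_typeII_dAlembert T h z <->
  (forall t, t \in `[0, T] -> lie_poisson_equations h z t).
Proof.
have e0 : 0 \in `[0, T] by rewrite in_itv /= lexx ltW.
have eT : T \in `[0, T] by rewrite in_itv /= lexx ltW.
split=> [dA|LP]; last first.
  move=> F FF eta delta_mu eta0 _; have := first_variation T0 sh sz FF eta0.
  rewrite (_ : \int[lebesgue_measure]_(t in `[0, T]) _ = 0) ?addr0//.
  rewrite -[RHS](mul0r (fine (lebesgue_measure (`[0, T]%classic : set R)))).
  rewrite -Rintegral_cst; last exact: measurable_itv.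
  apply: eq_Rintegral => t; rewrite inE => /LP/lie_poisson_residual[-> ->].
  by rewrite /pairing mul0mx mulmx0 mxE addr0.
pose eta t : 'rV[R]_n := t *: (residual_mu h z t)^T.
pose nu t : 'cV[R]_n := (T - t) *: (residual_g h z t)^T.
have sw1 t : t \in `[0, T] -> smooth_at (residual_g h z) t.
  by move=> tT; exact/residual_g_smooth/sz.
have sw2 t : t \in `[0, T] -> smooth_at (residual_mu h z) t.
  by move=> tT; exact/residual_mu_smooth/sz.
have seta t : t \in `[0, T] -> smooth_at eta t.
  move=> tT; apply: smooth_atZ; first exact: smooth_at_id.
  exact/smooth_at_trmx/sw2.
have sTt (t : R) : smooth_at (fun s : R => T - s) t.
  have s1 : smooth_at (fun s : R => (-1 : R) * s) t.
    by apply: smooth_atM; [exact: smooth_at_cst|exact: smooth_at_id].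
  apply: ext_smooth_at (smooth_atD (smooth_at_cst (T : R) t) s1) _ => s.
  by rewrite mulN1r.
have snu t : t \in `[0, T] -> smooth_at nu t.
  by move=> tT; apply: smooth_atZ => //; exact/smooth_at_trmx/sw1.
have FF := test_family_triv seta snu.
have etaE t : t \in `[0, T] -> _ := @test_family_eta _ _ seta snu t.
have nuE t := test_family_mu eta nu t.
have eta0 : ltrans_inv (velocity (fun e => (test_family eta nu e 0).1) 0) = 0.
  by rewrite etaE// /eta scale0r.
have nuT : derive1 (fun e => (test_family eta nu e T).2 : 'cV[R]_n) 0 = 0.
  by rewrite nuE /nu subrr scale0r.
have D1 := dA _ FF eta0 nuT.
have D2 := first_variation T0 sh sz FF eta0.
have add_eq (a b : R) : a + b = a -> b = 0.
  by move=> ab; apply: (@addrI _ a); rewrite ab addr0.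
have int0 := add_eq _ _ (etrans (esym (@derive_val _ _ _ _ _ _ _ D2))
  (@derive_val _ _ _ _ _ _ _ D1)).
pose q t : R := (T - t) * pairing (residual_g h z t)^T (residual_g h z t)
  + t * pairing (residual_mu h z t)^T^T (residual_mu h z t)^T.
have qE t : q t = pairing (nu t) (residual_g h z t) + pairing (residual_mu h z t) (eta t).
  by rewrite /q /pairing /nu /eta trmxK -scalemxAl -scalemxAr !mxE.
have q0 : \int[lebesgue_measure]_(t in `[0, T]) q t = 0.
  apply: etrans int0; apply: eq_Rintegral => t; rewrite inE => tT.
  apply: etrans (qE t) _.
  exact: (congr2 (fun a b => pairing a (residual_g h z t)
    + pairing (residual_mu h z t) b) (esym (nuE t)) (esym (etaE t tT))).
have cq t : t \in `[0, T] -> {for t, continuous q}.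
  move=> tT; apply: smooth_at_continuous.
  have s1 : smooth_at (fun s => pairing (nu s) (residual_g h z s)) t.
    by apply: smooth_at_pairing; [exact: snu|exact: sw1].
  have s2 : smooth_at (fun s => pairing (residual_mu h z s) (eta s)) t.
    by apply: smooth_at_pairing; [exact: sw2|exact: seta].
  by apply: ext_smooth_at (smooth_atD s1 s2) _ => s; rewrite qE.
have p0 t : t \in `[0, T] ->
    (0 <= (T - t) * pairing (residual_g h z t)^T (residual_g h z t)) /\
    (0 <= t * pairing (residual_mu h z t)^T^T (residual_mu h z t)^T).
  rewrite in_itv /= => /andP[t0 tT].
  by rewrite !mulr_ge0 ?pairing_tr_ge0// subr_ge0.
have q_ge0 t : t \in `[0, T] -> 0 <= q t.
  by move=> /p0[a b]; exact: addr_ge0.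
have w0 t : t \in `]0, T[ -> residual_g h z t = 0 /\ residual_mu h z t = 0.
  move=> toT; have tT : t \in `[0, T] by exact: subset_itv_oo_cc.
  have /eqP := Rintegral_eq0 cq q_ge0 q0 toT.
  have [a b] := p0 t tT; rewrite /q paddr_eq0// !mulf_eq0.
  move: toT; rewrite in_itv /= => /andP[t0 tlt].
  rewrite subr_eq0 (gt_eqF tlt) (gt_eqF t0) /=.
  move=> /andP[/eqP/pairing_tr_eq0 w1 /eqP/pairing_tr_eq0 w2].
  by split=> //; rewrite -[LHS]trmxK w2 trmx0.
move=> t tT; apply/lie_poisson_residual; split.
  apply: (continuous_itv_eq0 _ tT) => [s /w0[]//|].
  exact/smooth_at_continuous/sw1.
apply: (continuous_itv_eq0 _ tT) => [s /w0[]//|].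
exact/smooth_at_continuous/sw2.
Qed.

End FundamentalLemma.

(** * Left trivialization of the variational principle *)

Section LeftTrivialization.
Context {R : realType} {n : nat} {G : lieGroupType R n}.
Implicit Types (V : normedModType R) (c : chart R n G).
Implicit Types (H : cotangent_bundle G -> R).

Definition left_triv_inv (k : G * dual_lie_algebra G) : cotangent_bundle G :=
  Covector (ltrans_dual_inv k.1 k.2).

Lemma left_trivK : cancel (@left_triv R n G) left_triv_inv.
Proof. by case=> x p; rewrite /left_triv_inv /left_triv /= ltrans_dualK. Qed.

Lemma left_triv_invK : cancel left_triv_inv (@left_triv R n G).
Proof. by case=> x mu; rewrite /left_triv_inv /left_triv /= ltrans_dual_invK. Qed.

Lemma left_triv_hamiltonian_left_triv H k :
  left_triv_hamiltonian H (left_triv k) = H k.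
Proof. exact: (congr1 H (left_trivK k)). Qed.

Lemma lframe_canonical_p c (k : cotangent_bundle G) : atlas c ->
  cdom c (base k) -> lframe c (base k) *m canonical_p c k = (left_triv k).2.
Proof.
move=> ac ck; rewrite /left_triv /= ltrans_dualE /canonical_p mulmxA.
rewrite -lframe_change//; first exact: chart_at_atlas.
exact: chart_at_dom.
Qed.

Lemma canonical_pE c (k : cotangent_bundle G) : atlas c ->
  cdom c (base k) -> canonical_p c k = lcoframe c (base k) *m (left_triv k).2.
Proof.
move=> ac ck; rewrite -(lframe_canonical_p ac ck) mulmxA lcoframeK//.
by rewrite mul1mx.
Qed.

(** Over a chart domain the trivialization is multiplication of the momentum
    coordinates by the smooth invertible matrix [lframe]. *)
Lemma left_triv_smoothP V {fV : findim V} (f : V -> cotangent_bundle G) v :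
  cotangent_smooth_at f v <-> triv_smooth_at (left_triv \o f) v.
Proof.
set c := chart_at (base (f v)).
have ac : atlas c by exact: chart_at_atlas.
have cf : cdom c (base (f v)) by exact: chart_at_dom.
split=> -[sg sp]; (split; first exact: sg).
  have sg' : msmooth_at (@base R n G \o f) v := sg.
  have cn := msmooth_cdom_near sg cf.
  have sL : smooth_at (fun u => lframe c (base (f u))) v by exact: (lframe_smooth sg').
  apply: eq_smooth_at (smooth_at_mulmx sL sp); near=> u.
  by apply: lframe_canonical_p => //; near: u.
have sg' : msmooth_at (@base R n G \o f) v := sg.
have cn := msmooth_cdom_near sg' cf.
have sL : smooth_at (fun u => lcoframe c (base (f u))) v by exact: (lcoframe_smooth sg').
apply: eq_smooth_at (smooth_at_mulmx sL sp); near=> u.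
by apply/esym/canonical_pE => //; near: u.
Unshelve. all: by end_near. Qed.

Lemma pairing_left_triv g (p : cotangent g) (v : tangent g) :
  pairing (ltrans_dual p : dual_lie_algebra G) (ltrans_inv v) = pairing p v.
Proof.
rewrite /pairing ltrans_dualE ltrans_invE mulmxA -[_ *m _ *m lframe _ _]mulmxA.
rewrite lcoframeK ?mulmx1//; first exact: chart_at_atlas.
exact: chart_at_dom.
Qed.

Lemma action_left_triv (T : R) H (f : R -> cotangent_bundle G) :
  action_integral T H f =
  triv_action_integral T (left_triv_hamiltonian H) (left_triv \o f).
Proof.
apply: eq_Rintegral => t _.
by rewrite -(pairing_left_triv (covec (f t))) /= left_triv_hamiltonian_left_triv.
Qed.

(** The covector and the tangent vector sit at base points whose types agree but
    which are equal only by a proof. *)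
Lemma pairing_left_triv_eq x y (p : 'cV[R]_n * 'rV[R]_n) :
  x = y :> G -> pairing (@ltrans_dual R n G x p.1) (@ltrans_inv R n G y p.2)
    = pairing p.1 p.2.
Proof. by move=> ->; exact: pairing_left_triv. Qed.

(** Left trivialization is a bijection between the two kinds of families; it
    preserves the action, the boundary conditions and the boundary term. *)
Lemma dAlembert_left_triv (T : R) H (gamma : R -> cotangent_bundle G) :
  0 < T -> typeII_dAlembert T H gamma <->
    triv_typeII_dAlembert T (left_triv_hamiltonian H) (left_triv \o gamma).
Proof.
move=> T0; have eT : T \in `[0, T] by rewrite in_itv /= lexx ltW.
have actE (F : R -> R -> cotangent_bundle G) :
    (fun e => action_integral T H (F e)) =
    (fun e => triv_action_integral T (left_triv_hamiltonian H) (left_triv \o F e)).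
  by apply/funext => e; exact: action_left_triv.
have valE (F : R -> R -> cotangent_bundle G) : base (F 0 T) = base (gamma T) ->
    pairing (left_triv (gamma T)).2
      (ltrans_inv (velocity (fun e => base (F e T)) 0)) =
    pairing (covec (gamma T)) (velocity (fun e => base (F e T)) 0).
  move=> FT; exact: (@pairing_left_triv_eq _ _
    (covec (gamma T), velocity (fun e => base (F e T)) 0) (esym FT)).
split=> dA F [F0 sF] /=.
  pose F' e t := left_triv_inv (F e t).
  have FE e : left_triv \o F' e = F e.
    by apply/funext => t; exact: left_triv_invK.
  have F'0 t : t \in `[0, T] -> F' 0 t = gamma t.
    by move=> tT; rewrite /F' F0// /= left_trivK.
  have FF' : cotangent_family T gamma F'.
    split=> //; apply: filterS sF => e se t tT; apply/left_triv_smoothP.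
    have -> : left_triv \o (fun u : R * R => F' u.1 u.2) = (fun u => F u.1 u.2).
      by apply/funext => u; exact: left_triv_invK.
    exact: se.
  move=> eta0 mu0.
  have dg0 : velocity (fun e => base (F' e 0)) 0 = 0.
    rewrite -[LHS](@ltrans_invK R n G (base (F' 0 0))).
    by rewrite [ltrans_inv _]eta0 ltransE mul0mx.
  have dmu0 : derive1 (fun e => (left_triv (F' e T)).2 : 'cV[R]_n) 0 = 0.
    apply: etrans mu0; congr (derive1 _ 0); apply/funext => e.
    by rewrite /F' left_triv_invK.
  have D := dA F' FF' dg0 dmu0.
  have -> : (fun e => triv_action_integral T (left_triv_hamiltonian H) (F e)) =
      (fun e => action_integral T H (F' e)).
    by rewrite actE; apply/funext => e; rewrite FE.
  apply: is_derive_eq D _; apply/esym/(valE F').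
  exact: (congr1 base (F'0 T eT)).
pose F' e := left_triv \o F e.
have FF' : triv_family T (left_triv \o gamma) F'.
  split=> [t tT|]; first by rewrite /F' /= F0.
  apply: filterS sF => e se t tT.
  exact: ((@left_triv_smoothP _ _ (fun u : R * R => F u.1 u.2) (e, t)).1 (se t tT)).
move=> dg0 mu0.
have eta0 : ltrans_inv (velocity (fun e => (F' e 0).1) 0) = 0.
  have E : velocity (fun e => (F' e 0).1) 0 = 0 := dg0.
  by rewrite E ltrans_invE mul0mx.
have D := dA F' FF' eta0 mu0.
rewrite (actE F).
apply: is_derive_eq D _; apply: valE.
exact: (congr1 base (F0 T eT)).
Qed.

End LeftTrivialization.

(** * Hamilton's equations and the Lie-Poisson equations *)

Section HamiltonLiePoisson.
Context {R : realType} {n : nat} {G : lieGroupType R n}.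
Variables (H : cotangent_bundle G -> R) (sH : smooth_hamiltonian H).
Variables (gamma : R -> cotangent_bundle G) (t : R).
Hypothesis sgamma : cotangent_smooth_at gamma t.
Variables (c : chart R n G) (ac : atlas c) (cg : cdom c (base (gamma t))).

Let h := left_triv_hamiltonian H.
Let sh : triv_smooth_fun h := left_triv_hamiltonian_smooth sH.
Let g s : G := base (gamma s).
Let mu s : 'cV[R]_n := (left_triv (gamma s)).2.
Let p s : 'cV[R]_n := canonical_p c (gamma s).
Let X q : 'M[R]_n := lframe c (cinv c q).
Let L : 'M[R]_n := lframe c (g t).
Let zeta : 'rV[R]_n := partial_mu h (g t) (mu t).
Let dgh : 'cV[R]_n := ltrans_dual (partial_g h (g t) (mu t)).

Let Lp : L *m p t = mu t. Proof. exact: lframe_canonical_p. Qed.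

(* The trivialized momentum is [mu = L p]. *)
Let HE q p' : cimg c q -> H (of_canonical c q p') = h (cinv c q, X q *m p').
Proof.
move=> cq; have cx := cinv_cdom cq.
rewrite /h (left_triv_hamiltonianE _ _ ac cx) cmap_cinv// mulmxA.
by rewrite /X lcoframeK// mul1mx.
Qed.

Let logd_cst (V : normedModType R) (x : G) (w u : V) : logd (fun=> x) w u = 0.
Proof.
rewrite logd_unlock.
by have -> := derive_cst (chart_at x x) u w; rewrite mul0mx.
Qed.

Lemma hamilton_cograd :
  cograd (fun p' => H (of_canonical c (c (g t)) p')) (p t) = zeta *m L.
Proof.
have -> : (fun p' => H (of_canonical c (c (g t)) p')) = (fun p' => h (g t, L *m p')).
  apply/funext => p'; rewrite HE; last exact: cdom_cimg.
  by rewrite /X cmapK.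
apply/rowP => i; rewrite mxE.
have sm : smooth_at (fun p' : 'cV[R]_n => L *m p') (p t).
  by apply: smooth_at_mulmx; [exact: smooth_at_cst|exact: smooth_at_id].
set d : 'cV[R]_n := delta_mx i 0.
have D : 'D_d (fun p' : 'cV[R]_n => h (g t, L *m p')) (p t) =
    pairing ('D_d (fun p' : 'cV[R]_n => L *m p') (p t))
      (partial_mu h (g t) (L *m p t)) +
    pairing (ltrans_dual (partial_g h (g t) (L *m p t)))
      (logd (fun=> g t) d (p t)).
  exact: (triv_fun_derive sh (msmooth_cst (g t) (p t)) sm).
have D2 := derive_mulmx d (smooth_at_cst L (p t)) (smooth_at_id (p t)).
rewrite derive_cst mul0mx add0r derive_id in D2.
apply: etrans D _; rewrite logd_cst {2}/pairing mul0mx [X in _ + X]mxE addr0.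
rewrite D2 Lp /pairing -/zeta mulmxA -colE.
by rewrite mxE.
Qed.

Let sX : smooth_at X (c (g t)). Proof. exact: lframe_smooth_chart. Qed.

(** The frame depends on [q], whence the term containing the derivative of
    [X]; along [xi *m L] the group variable has logarithmic derivative [xi]. *)
Lemma hamilton_grad (xi : 'rV[R]_n) :
  (xi *m (L *m grad (fun q' => H (of_canonical c q' (p t))) (c (g t)))) 0 0 =
  (zeta *m ('D_(xi *m L) X (c (g t)) *m p t)) 0 0 + (xi *m dgh) 0 0.
Proof.
have cI : cimg c (c (g t)) by exact: cdom_cimg.
set f := fun q' => H (of_canonical c q' (p t)).
have sm : smooth_at (fun q => X q *m p t) (c (g t)).
  by apply: smooth_at_mulmx => //; exact: smooth_at_cst.
have sc : msmooth_at (cinv c) (c (g t)) by exact: msmooth_cinv.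
have sF : smooth_at (fun q => h (cinv c q, X q *m p t)) (c (g t)).
  exact: (triv_fun_smooth sh sc sm).
have Ff : \forall q \near c (g t), h (cinv c q, X q *m p t) = f q.
  by near=> q; rewrite /f HE//; near: q; exact: cimg_near.
have df := near_eq_differentiable Ff (smooth_at_differentiable sF).
have assoc (a : 'rV[R]_n) (M : 'M[R]_n) (b : 'cV[R]_n) :
  (a *m (M *m b)) 0 0 = (a *m M *m b) 0 0 by rewrite mulmxA.
apply: etrans (assoc _ _ _) (etrans (esym (gradE (xi *m L) df)) _).
have lE : logd (cinv c) (xi *m L) (c (g t)) = xi.
  have E := logd_chart (xi *m L) sc ac (cinv_cdom cI).
  rewrite E cmapK//.
  have -> : 'D_(xi *m L) (c \o cinv c) (c (g t)) = xi *m L.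
    rewrite -[RHS](derive_id (c (g t)) (xi *m L)); apply: near_eq_derive.
    by near=> q; rewrite /= cmap_cinv//; near: q; exact: cimg_near.
  by rewrite -mulmxA /L lframeK// mulmx1.
have D : 'D_(xi *m L) (fun q => h (cinv c q, X q *m p t)) (c (g t)) =
    pairing ('D_(xi *m L) (fun q => X q *m p t) (c (g t)))
      (partial_mu h (cinv c (c (g t))) (X (c (g t)) *m p t)) +
    pairing (ltrans_dual
        (partial_g h (cinv c (c (g t))) (X (c (g t)) *m p t)))
      (logd (cinv c) (xi *m L) (c (g t))).
  exact: (triv_fun_derive sh sc sm).
have D2 := derive_mulmxr (p t) (xi *m L) sX.
have at_gt x (m : 'cV[R]_n) a b : x = g t -> m = mu t ->
    pairing a (partial_mu h x m) + pairing (ltrans_dual (partial_g h x m)) b =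
    pairing a (partial_mu h (g t) (mu t)) +
    pairing (ltrans_dual (partial_g h (g t) (mu t))) b.
  exact: (congr2 (fun x m => pairing a (partial_mu h x m)
    + pairing (ltrans_dual (partial_g h x m)) b)).
have gE : cinv c (c (g t)) = g t by rewrite cmapK.
have XE : X (c (g t)) *m p t = mu t by rewrite /X cmapK.
have E0 : 'D_(xi *m L) (fun q => h (cinv c q, X q *m p t)) (c (g t)) =
  'D_(xi *m L) f (c (g t)) by exact: near_eq_derive.
apply: etrans (esym E0) _.
apply: etrans D _.
apply: etrans (at_gt _ _ _ _ gE XE) _.
exact: (congr2 (fun a b => pairing a zeta + pairing dgh b) D2 lE).
Unshelve. all: by end_near. Qed.

Let sg : msmooth_at g t. Proof. by case: sgamma. Qed.

(** Once [q' = zeta *m L] is known, [mu = L p] gives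
    [mu' = D_(zeta L) X p + L p'], and pairing with [xi] the terms in the
    derivatives of [X] form the structure equation for [zeta] and [xi]. *)
Lemma hamilton_lie_poisson :
  (derive1 (canonical_q c \o gamma) t =
     cograd (fun p' => H (of_canonical c (c (g t)) p')) (p t) /\
   derive1 (canonical_p c \o gamma) t =
     - grad (fun q' => H (of_canonical c q' (p t))) (c (g t))) <->
  lie_poisson_equations h (left_triv \o gamma) t.
Proof.
have LK : L *m lcoframe c (g t) = 1%:M by exact: lframeK.
have KL : lcoframe c (g t) *m L = 1%:M by exact: lcoframeK.
have smu : smooth_at mu t by exact: ((left_triv_smoothP gamma t).1 sgamma).2.
have cn : \forall s \near t, cdom c (g s) by exact: msmooth_cdom_near.
have sp : smooth_at p t.
  have sK : smooth_at (fun s => lcoframe c (g s)) t by exact: lcoframe_smooth.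
  apply: eq_smooth_at (smooth_at_mulmx sK smu); near=> s.
  by apply/esym/canonical_pE => //; near: s.
have sL : smooth_at (fun s => lframe c (g s)) t by exact: lframe_smooth.
have DL : 'D_1 (fun s => lframe c (g s)) t = 'D_(logd g 1 t *m L) X (c (g t)).
  exact: derive_lframe_along.
have Dq : 'D_1 (canonical_q c \o gamma) t = logd g 1 t *m L.
  by apply/esym; exact: logd_lframe.
set DX := 'D_(zeta *m L) X (c (g t)).
have Dmu : logd g 1 t = zeta -> 'D_1 mu t = DX *m p t + L *m 'D_1 p t.
  move=> gE; have E := @derive_mulmx R R _ _ _ (fun s => lframe c (g s)) p t 1 sL sp.
  have N : 'D_1 (fun s => lframe c (g s) *m p s) t = 'D_1 mu t.
    by apply: near_eq_derive; near=> s; apply: lframe_canonical_p => //; near: s.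
  by rewrite DL gE in E; exact: etrans (esym N) E.
set gr := grad _ _; set adz : 'cV[R]_n := ad_dual (zeta : lie_algebra G) (mu t).
have cancr (a b : 'rV[R]_n) (M K : 'M[R]_n) :
    M *m K = 1%:M -> a *m M = b *m M -> a = b.
  by move=> MK E; rewrite -[a]mulmx1 -[b]mulmx1 -MK !mulmxA E.
have cancl (a b : 'cV[R]_n) (M K : 'M[R]_n) :
    K *m M = 1%:M -> M *m a = M *m b -> a = b.
  by move=> KM E; rewrite -[a]mul1mx -[b]mul1mx -KM -!mulmxA E.
have dist (a : 'rV[R]_n) (b b' : 'cV[R]_n) :
  (a *m (b + b')) 0 0 = (a *m b) 0 0 + (a *m b') 0 0 by rewrite mulmxDr mxE.
have neg (a : 'rV[R]_n) (b : 'cV[R]_n) : (a *m (- b)) 0 0 = - (a *m b) 0 0.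
  by rewrite mulmxN mxE.
have comb (a b d : 'rV[R]_n) (A B D : 'M[R]_n) (v : 'cV[R]_n) :
    a *m A - b *m B = d *m D ->
    (a *m (A *m v)) 0 0 - (b *m (B *m v)) 0 0 = (d *m (D *m v)) 0 0.
  by move=> E; rewrite !mulmxA -E mulmxBl !mxE.
have fin (a b m s1 s2 k d r : R) : m = s1 + a -> b = s2 + k -> s1 - s2 = d ->
    r = - k + d -> a = - b <-> m = r.
  by move=> -> -> <- ->; split=> [->|E]; lra.
have core : logd g 1 t = zeta -> forall xi : 'rV[R]_n,
    (xi *m (L *m 'D_1 p t)) 0 0 = - (xi *m (L *m gr)) 0 0 <->
    (xi *m 'D_1 mu t) 0 0 = (xi *m (- dgh + adz)) 0 0.
  move=> gE xi.
  have Em := etrans (congr1 (fun A : 'cV[R]_n => (xi *m A) 0 0) (Dmu gE))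
    (dist _ _ _).
  have Eb := hamilton_grad xi.
  have Ed : (xi *m (DX *m p t)) 0 0 -
      (zeta *m ('D_(xi *m L) X (c (g t)) *m p t)) 0 0 = (xi *m adz) 0 0.
    have S := structure_equation zeta xi ac cg.
    have P := pairing_ad (zeta : lie_algebra G) xi (mu t).
    apply: etrans (comb _ _ _ _ _ _ _ S) (etrans _ P).
    exact: (congr1 (fun m : 'cV[R]_n => pairing m (ad (zeta : lie_algebra G) xi)) Lp).
  have Ek := etrans (dist xi (- dgh) adz) (congr1 (fun a => a + _) (neg xi dgh)).
  exact: (fin _ _ _ _ _ _ _ _ Em Eb Ed Ek).
split=> [[E1 E2]|[/velocity_ltransP gE muE]].
  have gE : logd g 1 t = zeta.
    have E : logd g 1 t *m L = zeta *m L.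
      by rewrite -Dq -derive1E E1; exact: hamilton_cograd.
    exact: cancr LK E.
  have E2' : 'D_1 p t = - gr by rewrite -derive1E; exact: E2.
  split; first exact/velocity_ltransP.
  rewrite derive1E; apply: mulmx_cV_inj => xi; apply/(core gE xi).
  by rewrite E2' mulmxN neg.
split.
  rewrite derive1E; apply: etrans Dq _; rewrite gE.
  exact: esym hamilton_cograd.
rewrite derive1E.
have LE : L *m 'D_1 p t = L *m (- gr).
  apply: mulmx_cV_inj => xi; rewrite mulmxN neg; apply/(core gE xi).
  by rewrite -derive1E; exact: (congr1 (fun v : 'cV[R]_n => (xi *m v) 0 0) muE).
exact: cancl KL LE.
Unshelve. all: by end_near. Qed.

End HamiltonLiePoisson.

Theorem theorem2p1 (R : realType) (n : nat) (G : lieGroupType R n)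
  (H : cotangent_bundle G -> R) (T : R) (g0 : G) (mu1 : dual_lie_algebra G)
  (gamma : R -> cotangent_bundle G) :
  smooth_hamiltonian H ->
  0 < T ->
  (forall t, t \in `[0, T] -> cotangent_smooth_at gamma t) ->
  let g := base \o gamma in
  let h := left_triv_hamiltonian H in
  let z := left_triv \o gamma in
  [<->
    [/\ g 0 = g0,
        covec (gamma T) = ltrans_dual_inv (g T) mu1 &
        typeII_dAlembert T H gamma];
    [/\ (forall t, t \in `[0, T] -> hamilton_equations H gamma t),
        g 0 = g0 &
        covec (gamma T) = ltrans_dual_inv (g T) mu1];
    [/\ g 0 = g0,
        (z T).2 = mu1 &
        triv_typeII_dAlembert T h z];
    [/\ (forall t, t \in `[0, T] -> lie_poisson_equations h z t),
        g 0 = g0 &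
        (z T).2 = mu1]].
Proof.
move=> sH T0 sgamma g h z.
have eT : T \in `[0, T] by rewrite in_itv /= lexx ltW.
have sh : triv_smooth_fun h by exact: left_triv_hamiltonian_smooth.
have sz : smooth_curve T z.
  by move=> t tT; exact: ((left_triv_smoothP gamma t).1 (sgamma t tT)).
have muT : covec (gamma T) = ltrans_dual_inv (g T) mu1 <-> (z T).2 = mu1.
  rewrite /z /g /=; split=> [->|<-]; first exact: ltrans_dual_invK.
  by rewrite ltrans_dualK.
have i_iii : typeII_dAlembert T H gamma <-> triv_typeII_dAlembert T h z.
  exact: dAlembert_left_triv.
have iii_iv : triv_typeII_dAlembert T h z <->
    forall t, t \in `[0, T] -> lie_poisson_equations h z t.
  exact: triv_dAlembert_lie_poisson.
have ii_iv t : t \in `[0, T] ->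
    hamilton_equations H gamma t <-> lie_poisson_equations h z t.
  move=> tT; have st := sgamma t tT; split=> [Ham|LP c ac cg].
    have ac : atlas (chart_at (g t)) by exact: chart_at_atlas.
    have cg : cdom (chart_at (g t)) (base (gamma t)) by exact: chart_at_dom.
    exact: ((hamilton_lie_poisson sH st ac cg).1 (Ham _ ac cg)).
  exact: ((hamilton_lie_poisson sH st ac cg).2 LP).
split.
  move=> [g0E pT /i_iii/iii_iv LP]; split=> // t tT.
  exact/(ii_iv t tT)/LP.
split.
  move=> [Ham g0E /muT pT]; split=> //; apply/iii_iv => t tT.
  exact/(ii_iv t tT)/Ham.
split.
  by move=> [g0E pT /iii_iv LP].
by move=> [LP g0E /muT pT]; split=> //; exact/i_iii/iii_iv.
Qed.
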